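(* Let $n\ge 1$, let $a>0$, $b>0$ be constants, and let $f:\mathbb{R}^n\times[0,\infty)\to\mathbb{R}$ be a positive solution of $$f_t=\Delta f+af-bf^3 .$$ Let $(x_1,t_1),(x_2,t_2)\in\mathbb{R}^n\times[0,\infty)$ with $0<t_1<t_2$. Then $$\frac{f(x_2,t_2)}{f(x_1,t_1)}\ \ge\ \exp\left\{\frac{-|x_2-x_1|^2}{4(t_2-t_1)}\right\}\cdot\exp\left\{a\left(1+\frac n3\right)(t_2-t_1)\right\}\cdot\left(\frac{1-e^{2at_1}}{1-e^{2at_2}}\right)^{2n/3}.$$
   Context: The equation $f_t=\Delta f+af-bf^3$ is the Newell-Whitehead equation; $\Delta$ is the Laplacian in the space variable $x\in\mathbb{R}^n$, and $|\cdot|$ is the Euclidean norm. ''Solution'' means a classical solution. *)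

(* Defs.v *)
From HB Require Import structures.
From mathcomp Require Import all_boot all_order all_algebra.
From mathcomp Require Import all_classical all_reals all_analysis.

Set Implicit Arguments.
Unset Strict Implicit.
Unset Printing Implicit Defensive.

Import Order.TTheory GRing.Theory Num.Theory.
Import numFieldNormedType.Exports.

Local Open Scope classical_set_scope.
Local Open Scope ring_scope.

(* The norm [`|x|] that the library puts on ['rV[R]_n] is the sup norm. It
   induces the usual topology, but it is not the Euclidean norm. *)
Definition enorm (R : realType) (n : nat) (x : 'rV[R]_n) : R :=
  Num.sqrt (\sum_(i < n) x 0 i ^+ 2).

Section newell_whitehead.
Context {R : realType} {n : nat}.
Implicit Types f g : 'rV[R]_n -> R -> R.

Definition dx (i : 'I_n) f : 'rV[R]_n -> R -> R :=
  fun x t => 'D_(delta_mx 0 i) (f ^~ t) x.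

Definition dt f : 'rV[R]_n -> R -> R := fun x t => derive1 (f x) t.

Definition laplacian f : 'rV[R]_n -> R -> R :=
  fun x t => \sum_(i < n) dx i (dx i f) x t.

Definition jointly_continuous g :=
  forall x t, 0 < t -> {for (x, t), continuous (fun p => g p.1 p.2)}.

(* [f] is of class C^{2,1} on R^n x (0, +oo): C^2 in space and C^1 in time. *)
Definition C21 f : Prop :=
  [/\ forall x t, 0 < t -> derivable (f x) t 1,
      forall i x t, 0 < t -> derivable (f ^~ t) x (delta_mx 0 i),
      forall i j x t, 0 < t -> derivable (dx j f ^~ t) x (delta_mx 0 i),
      jointly_continuous f /\ jointly_continuous (dt f)
    & (forall i, jointly_continuous (dx i f)) /\
      (forall i j, jointly_continuous (dx i (dx j f)))].

(* Functions on R^n x [0, +oo) are represented by total functions, whose values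
   at negative times are irrelevant. As usual for a parabolic equation, a
   classical solution is C^{2,1} and satisfies the equation for t > 0, and is
   continuous up to t = 0. *)
Definition NW_solution (a b : R) f : Prop :=
  [/\ {within [set p : 'rV[R]_n * R | 0 <= p.2],
        continuous (fun p => f p.1 p.2)},
      C21 f
    & forall x t, 0 < t ->
        dt f x t = laplacian f x t + a * f x t - b * f x t ^+ 3].

End newell_whitehead.

(* Main.v *)
Require Import Defs.
From mathcomp Require Import all_boot all_order all_algebra.
From mathcomp Require Import all_classical all_reals all_analysis.
From mathcomp Require Import ring lra.
Import Order.TTheory GRing.Theory Num.Theory.
Import numFieldNormedType.Exports.
Local Open Scope classical_set_scope.
Local Open Scope ring_scope.

(* Put [u = ln f], [w = b e^{2u}], so that [u_t = Lap u + |grad u|^2 + a - w].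
   The heart of the proof is the pointwise estimate
     [Lap u - w + n psi(t) >= 0],
     [psi(t) = (a / 3) (3 e^{2at} + 1) / (e^{2at} - 1)],
   where [psi] solves [2 psi' = (a - psi) (a + 3 psi)].  Along the segment from
   [(x1, t1)] to [(x2, t2)] it gives, after completing a square,
   [du/dt >= a - n psi - |velocity|^2 / 4], and integrating this is the theorem.

   The estimate is a maximum principle for
     [Lap u + beta |grad u|^2 - w + n (1 + tau) psi(t - delta) + sum_i k(x_i)],
   where the barrier [k] blows up on the boundary of a cube and the term in
   [beta > 0] absorbs the gradient of the barrier; the cube then exhausts the
   space and [beta, tau, delta] tend to [0].  No growth condition on [f] is
   needed.  Since [f] is only [C^{2,1}], the quantity above cannot be
   differentiated: [Lap u] and [grad u] are first replaced by difference
   quotients of step [h], for which the Bochner identity is an exact algebraic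
   identity, and [h] tends to [0] at the minimum points, by compactness. *)

(** * One-variable calculus *)

Section Calculus.
Context {R : realType}.
Local Set Implicit Arguments.
Local Unset Strict Implicit.
Local Unset Printing Implicit Defensive.
Implicit Types (F G : R -> R) (x a b : R).

(* Unlike [is_derive] this is not a class: derivatives are computed lemma by
   lemma, without instance resolution interfering. *)
Definition has_derive F x (d : R) : Prop := is_derive x (1 : R) F d.

Lemma has_derive_eq F x d d' : has_derive F x d' -> d' = d -> has_derive F x d.
Proof. by move=> ? <-. Qed.

Lemma has_derive_ext F G x d d' :
  has_derive G x d' -> F =1 G -> d' = d -> has_derive F x d.
Proof. by move=> ? /funext -> <-. Qed.

Lemma has_derive_cst (c x : R) : has_derive (fun=> c) x 0.
Proof. exact: is_derive_cst. Qed.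

Lemma has_derive_id x : has_derive id x 1.
Proof. exact: is_derive_id. Qed.

Lemma has_deriveD F G x dF dG : has_derive F x dF -> has_derive G x dG ->
  has_derive (fun s => F s + G s) x (dF + dG).
Proof. by move=> ? ?; exact: is_deriveD. Qed.

Lemma has_deriveB F G x dF dG : has_derive F x dF -> has_derive G x dG ->
  has_derive (fun s => F s - G s) x (dF - dG).
Proof. by move=> ? ?; exact: is_deriveB. Qed.

Lemma has_deriveM F G x dF dG : has_derive F x dF -> has_derive G x dG ->
  has_derive (fun s => F s * G s) x (dF * G x + F x * dG).
Proof.
move=> HF HG; apply: (is_derive_eq (is_deriveM HF HG)).
by rewrite addrC; congr (_ + _); rewrite mulrC.
Qed.

Lemma has_deriveZ c F x dF :
  has_derive F x dF -> has_derive (fun s => c * F s) x (c * dF).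
Proof. by move=> ?; exact: is_deriveZ. Qed.

Lemma has_derive_sqr F x dF :
  has_derive F x dF -> has_derive (fun s => F s ^+ 2) x (2 * F x * dF).
Proof.
move=> H; rewrite (_ : (fun s => _) = fun s => F s * F s).
  by apply: (has_derive_eq (has_deriveM H H)); ring.
by apply/funext => s; rewrite expr2.
Qed.

Lemma has_deriveV F x dF : has_derive F x dF -> F x != 0 ->
  has_derive (fun s => (F s)^-1) x (- dF / F x ^+ 2).
Proof.
move=> H F0; apply: (is_derive_eq (is_deriveV F0 H)).
by rewrite /GRing.scale /= mulrC mulrN mulNr.
Qed.

Lemma has_derive_sum n (F : 'I_n -> R -> R) x (dF : 'I_n -> R) :
  (forall i, has_derive (F i) x (dF i)) ->
  has_derive (fun s => \sum_(i < n) F i s) x (\sum_(i < n) dF i).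
Proof.
move=> H; rewrite (_ : (fun s => _) = \sum_(i < n) F i).
  exact: is_derive_sum.
by apply/funext => s; rewrite fct_sumE.
Qed.

Lemma has_derive_comp F G x dF dG : has_derive F (G x) dF ->
  has_derive G x dG -> has_derive (fun s => F (G s)) x (dF * dG).
Proof. exact: is_derive1_comp. Qed.

Lemma has_derive_expR F x dF :
  has_derive F x dF -> has_derive (fun s => expR (F s)) x (expR (F x) * dF).
Proof. by apply: has_derive_comp; exact: is_derive_expR. Qed.

Lemma has_derive_ln F x dF : has_derive F x dF -> 0 < F x ->
  has_derive (fun s => ln (F s)) x (dF / F x).
Proof.
move=> H F0; rewrite mulrC.
by apply: has_derive_comp H; exact: is_derive1_ln.
Qed.

Lemma has_derive_shift F x c dF :
  has_derive F (x + c) dF -> has_derive (fun s => F (s + c)) x dF.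
Proof.
move=> H; rewrite -[dF]mulr1; apply: (has_derive_comp (G := +%R^~ c)) => //.
by apply: (has_derive_eq (has_deriveD (has_derive_id x) (has_derive_cst c x))); rewrite addr0.
Qed.

Lemma has_derive_opp F x dF :
  has_derive F (- x) dF -> has_derive (fun s => F (- s)) x (- dF).
Proof.
move=> H; rewrite -mulrN1; apply: has_derive_comp => //.
exact: is_deriveNid.
Qed.

Lemma mvt F (dF : R -> R) a b : a < b ->
  (forall x, a <= x <= b -> has_derive F x (dF x)) ->
  exists2 c, a < c < b & F b - F a = dF c * (b - a).
Proof.
move=> ab H.
have [||c cab E] := @MVT _ F dF a b ab.
- by move=> x; rewrite in_itv /= => /andP[? ?]; apply: H; rewrite !ltW.
- apply: derivable_within_continuous => x; rewrite in_itv /= => xab.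
  exact: (@ex_derive _ _ _ _ _ _ _ (H x xab)).
by exists c => //; move: cab; rewrite in_itv.
Qed.

Lemma rolle F (dF : R -> R) a b : a < b -> F a = F b ->
  (forall x, a <= x <= b -> has_derive F x (dF x)) ->
  exists2 c, a < c < b & dF c = 0.
Proof.
move=> ab E H; have [c cab E'] := mvt ab H.
exists c => //; move: E'; rewrite E subrr => /esym/eqP.
by rewrite mulf_eq0 subr_eq0 [b == a]gt_eqF// orbF => /eqP.
Qed.

Lemma nondecreasing_derive F (dF : R -> R) a b : a <= b ->
  (forall x, a <= x <= b -> has_derive F x (dF x)) ->
  (forall x, a <= x <= b -> 0 <= dF x) -> F a <= F b.
Proof.
rewrite le_eqVlt => /predU1P[-> //|ab H H0].
have [c /andP[ac cb] E] := mvt ab H.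
by rewrite -subr_ge0 E mulr_ge0// ?subr_ge0 ?H0 ?ltW.
Qed.

(** Rolle applied to the symmetrised function, followed by the mean value theorem for [dF]. No
    continuity of [ddF] is required, and the intermediate point stays within [h], which later gives
    convergence by squeezing. *)
Lemma second_difference F (dF ddF : R -> R) h : 0 < h ->
  (forall x, -h <= x <= h -> has_derive F x (dF x)) ->
  (forall x, -h <= x <= h -> has_derive dF x (ddF x)) ->
  exists2 c, `|c| <= h & F h + F (- h) - 2 * F 0 = h ^+ 2 * ddF c.
Proof.
move=> h0 H1 H2.
pose C := F h + F (- h) - 2 * F 0.
(* The quadratic correction is scaled so that [G 0 = G h = 2 * F 0]. *)
pose G s := F s + F (- s) - s ^+ 2 * (C / h ^+ 2).
have hn0 : h != 0 by rewrite gt_eqF.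
have [||s /andP[s0 sh] Es] := @rolle G (fun s => dF s - dF (- s) - 2 * s * (C / h ^+ 2)) 0 h h0.
- by rewrite /G /C oppr0; field.
- move=> x /andP[x0 xh]; apply: has_derive_eq.
    apply: has_deriveB; first apply: has_deriveD.
    + by apply: H1; apply/andP; split; lra.
    + by apply: has_derive_opp; apply: H1; apply/andP; split; lra.
    apply: has_deriveM; last exact: has_derive_cst.
    by apply: has_derive_sqr; exact: has_derive_id.
  by rewrite /=; ring.
have [||c /andP[c0 cs] Ec] := @mvt dF ddF (- s) s.
- lra.
- by move=> x /andP[? ?]; apply: H2; apply/andP; split; lra.
exists c; first by rewrite ler_norml; apply/andP; split; lra.
have : 2 * s * (h ^+ 2 * ddF c - C) = 0.
  transitivity (h ^+ 2 * (dF s - dF (- s) - 2 * s * (C / h ^+ 2))); last by rewrite Es mulr0.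
  by rewrite Ec; field.
by move=> /eqP; rewrite mulf_eq0 mulf_eq0 (gt_eqF s0) pnatr_eq0 /= subr_eq0 => /eqP ->.
Qed.

(** Fermat gives the first claim. If [ddF < 0], then [dF] is negative just to the right of 0 and the
    mean value theorem pushes [F] below [F 0]. The second derivative is needed at 0 only. *)
Lemma second_derivative_test F (dF : R -> R) ddF e : 0 < e ->
  (forall s, `|s| < e -> has_derive F s (dF s)) -> has_derive dF 0 ddF ->
  (forall s, `|s| < e -> F 0 <= F s) -> dF 0 = 0 /\ 0 <= ddF.
Proof.
move=> e0 H1 H2 Hmin.
have d0 : dF 0 = 0.
  have H : has_derive F (0 : R) 0.
    apply: (@derive1_at_min _ F (- e) e); first by lra.
    - move=> t; rewrite in_itv /= => ht.
      by apply: (@ex_derive _ _ _ _ _ _ _ (H1 t _)); rewrite ltr_norml.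
    - by rewrite in_itv /=; apply/andP; split; lra.
    - by move=> t; rewrite in_itv /= => ht; apply: Hmin; rewrite ltr_norml.
  have := H1 0; rewrite normr0 => /(_ e0) H'.
  by rewrite -(@derive_val _ _ _ _ _ _ _ H') (@derive_val _ _ _ _ _ _ _ H).
split => //; rewrite leNgt; apply/negP => dd0.
have [Hd Hv] := H2.
have C : (h^-1 * (dF (h + 0) - dF 0)) @[h --> 0^'] --> ddF.
  move: Hd; rewrite /derivable -Hv /derive => /cvgP/=.
  by under eq_fun do rewrite [_ *: 1]mulr1.
have N : \forall h \near (0:R)^', h^-1 * (dF (h + 0) - dF 0) < 0.
  exact: cvgr_lt C _ dd0.
move: N => -[r /= r0 Hr].
pose m := Num.min (r / 2) (e / 2).
have m0 : 0 < m by rewrite lt_min; apply/andP; split; lra.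
have mr : m <= r / 2 by rewrite ge_min lexx.
have me : m <= e / 2 by rewrite ge_min lexx orbT.
have [|c /andP[c0 cm] E] := @mvt F dF 0 m m0.
  move=> x /andP[x0 xm]; apply: H1; rewrite ger0_norm //; lra.
have : dF c < 0.
  have /= := Hr c; rewrite sub0r normrN gtr0_norm // addr0 d0 subr0.
  have -> : c < r by lra.
  by move=> /(_ isT (lt0r_neq0 c0)); rewrite pmulr_rlt0 ?invr_gt0.
have lt_me : m < e by lra.
move=> dc; have := Hmin m; rewrite gtr0_norm // => /(_ lt_me); rewrite -subr_ge0 E subr0 pmulr_lge0 //; lra.
Qed.

(** Only earlier values are compared, so the test also applies on the final time slice, as a
    parabolic maximum principle needs. *)
Lemma derive_left_min F x dF e : 0 < e -> has_derive F x dF ->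
  (forall s, x - e < s <= x -> F x <= F s) -> dF <= 0.
Proof.
move=> e0 [Hd Hv] Hmin; rewrite leNgt; apply/negP => d0.
have C : (h^-1 * (F (h + x) - F x)) @[h --> 0^'] --> dF.
  move: Hd; rewrite /derivable -Hv /derive => /cvgP/=.
  by under eq_fun do rewrite [_ *: 1]mulr1.
have N : \forall h \near (0:R)^', 0 < h^-1 * (F (h + x) - F x).
  exact: cvgr_gt C _ d0.
move: N => -[r /= r0 Hr].
pose m := Num.min (r / 2) (e / 2).
have m0 : 0 < m by rewrite lt_min; apply/andP; split; lra.
have mr : m <= r / 2 by rewrite ge_min lexx.
have me : m <= e / 2 by rewrite ge_min lexx orbT.
have /= := Hr (- m); rewrite sub0r opprK gtr0_norm // oppr_eq0 gt_eqF //.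
have -> : m < r by lra.
move=> /(_ isT isT); rewrite invrN mulNr oppr_gt0 pmulr_rlt0 ?invr_gt0//.
apply/negP; rewrite -leNgt subr_ge0; apply: Hmin; apply/andP; split; lra.
Qed.

End Calculus.

(** * The time-dependent rate and the spatial barrier *)

Section Barriers.
Context {R : realType}.
Local Set Implicit Arguments.
Local Unset Strict Implicit.
Local Unset Printing Implicit Defensive.

(** The function [psi] of the overview. With [E = expR (2 * a * t)] it equals
    [a + 4 * a / (3 * (E - 1))], so it decreases from infinity at [t = 0] towards [a]. *)
Definition rate (a t : R) : R :=
  a * (3 * expR (2 * a * t) + 1) / (3 * (expR (2 * a * t) - 1)).

Lemma expR2_gt1 (a t : R) : 0 < a -> 0 < t -> 1 < expR (2 * a * t).
Proof. by move=> a0 t0; rewrite expR_gt1 !mulr_gt0. Qed.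

Lemma rate_ge (a t : R) : 0 < a -> 0 < t -> a <= rate a t.
Proof.
move=> a0 t0; have E1 := expR2_gt1 a0 t0; rewrite /rate.
rewrite ler_pdivlMr; last by lra.
by rewrite ler_pM2l //; lra.
Qed.

(** The Riccati equation [2 psi' = (a - psi) (a + 3 psi)], with the product expanded. *)
Lemma has_derive_rate (a t : R) : 0 < a -> 0 < t ->
  has_derive (rate a) t ((a ^+ 2 + 2 * a * rate a t - 3 * rate a t ^+ 2) / 2).
Proof.
move=> a0 t0; have E1 := expR2_gt1 a0 t0.
have HE : has_derive (fun s => expR (2 * a * s)) t (expR (2 * a * t) * (2 * a)).
  by apply: has_derive_expR; apply: (has_derive_eq (has_deriveZ _ (has_derive_id t))); rewrite mulr1.
have N : 3 * (expR (2 * a * t) - 1) != 0 by apply: lt0r_neq0; lra.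
have HN : has_derive (fun s => a * (3 * expR (2 * a * s) + 1)) t (a * (3 * (expR (2 * a * t) * (2 * a)) + 0)).
  by apply: has_deriveZ; apply: has_deriveD; [exact: has_deriveZ|exact: has_derive_cst].
have HD : has_derive (fun s => 3 * (expR (2 * a * s) - 1)) t (3 * (expR (2 * a * t) * (2 * a) - 0)).
  by apply: has_deriveZ; apply: has_deriveB => //; exact: has_derive_cst.
apply: (has_derive_ext (has_deriveM HN (has_deriveV HD N))) => //.
have N1 : expR (2 * a * t) - 1 != 0 by apply: lt0r_neq0; lra.
by rewrite /rate; field.
Qed.

(** This blow-up keeps the minimisers away from the initial time slice. *)
Lemma rate_unbounded (a e M : R) : 0 < a -> 0 < e ->
  exists t, [/\ 0 < t, t < e & M < rate a t].
Proof.
move=> a0 e0.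
(* Here [m] is the value of [expR (2 * a * t) - 1] at the witness. The first bound keeps the time
   below [e], the second makes [4 * a / (3 * m)] at least [|M| + 1]. *)
pose m := Num.min (a * e) (4 * a / (3 * (`|M| + 1))).
have M0 := normr_ge0 M.
have m0 : 0 < m by rewrite lt_min mulr_gt0 //= divr_gt0 //; lra.
have me : m <= a * e by rewrite ge_min lexx.
have mM : m <= 4 * a / (3 * (`|M| + 1)) by rewrite ge_min lexx orbT.
have L0 : 0 < ln (1 + m) by apply: ln_gt0; lra.
have Lm : ln (1 + m) <= m by apply: le_ln1Dx; lra.
exists (ln (1 + m) / (2 * a)); split.
- by rewrite divr_gt0 //; lra.
- rewrite ltr_pdivrMr; last by lra.
  by apply: le_lt_trans Lm _; nra.
have -> : rate a (ln (1 + m) / (2 * a)) = a + 4 * a / (3 * m).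
  rewrite /rate (_ : 2 * a * _ = ln (1 + m)); last by field; apply: lt0r_neq0.
  by rewrite lnK ?posrE; [field; apply: lt0r_neq0| lra].
apply: le_lt_trans (ler_norm M) _.
apply: (@lt_trans _ _ (`|M| + 1)); first by lra.
suff : `|M| + 1 <= 4 * a / (3 * m) by lra.
rewrite ler_pdivlMr; last by lra.
move: mM; rewrite ler_pdivlMr; last by lra.
by lra.
Qed.

(** With exponent 2 the quantities [k ^+ 2], [k''] and [k' ^+ 2 / k] all blow up like the inverse
    fourth power of the gap [r ^+ 2 - s ^+ 2], so the first can absorb the other two. *)
Definition barrier (A r s : R) : R := A / (r ^+ 2 - s ^+ 2) ^+ 2.
Definition barrier1 (A r s : R) : R := 4 * A * s / (r ^+ 2 - s ^+ 2) ^+ 3.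
Definition barrier2 (A r s : R) : R :=
  4 * A / (r ^+ 2 - s ^+ 2) ^+ 3 + 24 * A * s ^+ 2 / (r ^+ 2 - s ^+ 2) ^+ 4.

Lemma sqr_gap_gt0 (r s : R) : `|s| < r -> 0 < r ^+ 2 - s ^+ 2.
Proof.
by move=> sr; rewrite subr_gt0 -(real_normK (num_real s)) ltr_pXn2r ?nnegrE// (le_trans _ (ltW sr)).
Qed.

Lemma has_derive_gap (r s : R) : has_derive (fun y => r ^+ 2 - y ^+ 2) s (- (2 * s)).
Proof.
apply: (has_derive_eq (has_deriveB (has_derive_cst _ _) (has_derive_sqr (has_derive_id s)))).
by rewrite /=; ring.
Qed.

Lemma has_derive_barrier (A r s : R) : `|s| < r ->
  has_derive (barrier A r) s (barrier1 A r s).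
Proof.
move=> /sqr_gap_gt0/lt0r_neq0 N.
have N2 : (r ^+ 2 - s ^+ 2) ^+ 2 != 0 by rewrite expf_neq0.
apply: (has_derive_ext (has_deriveZ A (has_deriveV (has_derive_sqr (has_derive_gap r s)) N2))) => //.
by rewrite /barrier1 ; field.
Qed.

Lemma has_derive_barrier1 (A r s : R) : `|s| < r ->
  has_derive (barrier1 A r) s (barrier2 A r s).
Proof.
move=> /sqr_gap_gt0/lt0r_neq0 N.
have N3 : (r ^+ 2 - s ^+ 2) ^+ 3 != 0 by rewrite expf_neq0.
have H3 : has_derive (fun y => (r ^+ 2 - y ^+ 2) ^+ 3) s (3 * (r ^+ 2 - s ^+ 2) ^+ 2 * - (2 * s)).
  have := has_deriveM (has_derive_gap r s) (has_derive_sqr (has_derive_gap r s)).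
  rewrite (_ : (fun y => _) = (fun y => (r ^+ 2 - y ^+ 2) ^+ 3)); last first.
    by apply/funext => y; rewrite -exprS.
  by move/has_derive_eq; apply; ring.
apply: (has_derive_ext (has_deriveM (has_deriveZ (4 * A) (has_derive_id s)) (has_deriveV H3 N3))) => //.
by rewrite /barrier2 /=; field.
Qed.

Lemma barrier_ge0 (A r s : R) : 0 <= A -> 0 <= barrier A r s.
Proof. by move=> A0; rewrite divr_ge0 // exprn_even_ge0. Qed.

(** After factoring out [A / g ^+ 4], with [g] the gap, one completes a square in [p]. In
    [c * A = 28 r^2 + 16 r^2 / e] the first term covers [4 g + 24 s^2] and the second covers the
    remainder [16 s^2 / e] of the square. *)
Lemma barrier_ineq (A c e r s p : R) : 0 < c -> 0 < e -> `|s| < r ->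
  A = (28 + 16 / e) / c * r ^+ 2 ->
  barrier2 A r s + 2 * p * barrier1 A r s <=
  c * barrier A r s ^+ 2 + e * barrier A r s * p ^+ 2.
Proof.
move=> c0 e0 sr AE; have g0 := sqr_gap_gt0 sr.
have g1 : r ^+ 2 - s ^+ 2 <= r ^+ 2 by rewrite gerBl sqr_ge0.
have s2 : s ^+ 2 <= r ^+ 2 by lra.
have r0 : 0 < r ^+ 2 by apply: lt_le_trans g0 g1.
set g := r ^+ 2 - s ^+ 2 in g0 g1 *.
have A0 : 0 < A.
  by rewrite AE; apply: mulr_gt0 => //; apply: divr_gt0 => //; apply: addr_gt0 => //; apply: divr_gt0.
rewrite -subr_ge0.
have -> : c * barrier A r s ^+ 2 + e * barrier A r s * p ^+ 2 -
  (barrier2 A r s + 2 * p * barrier1 A r s) =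
  A / g ^+ 4 * (c * A + e * p ^+ 2 * g ^+ 2 - 4 * g - 24 * s ^+ 2 - 8 * p * s * g).
  by rewrite /barrier /barrier1 /barrier2 -/g; field; apply: lt0r_neq0.
apply: mulr_ge0; first by rewrite divr_ge0 ?exprn_ge0 ?ltW.
have -> : c * A = 28 * r ^+ 2 + 16 * r ^+ 2 / e by rewrite AE; field; rewrite !gt_eqF.
have -> : e * p ^+ 2 * g ^+ 2 = (e * p * g - 4 * s) ^+ 2 / e + 8 * p * s * g - 16 * s ^+ 2 / e.
  by field; rewrite gt_eqF.
have : 0 <= (e * p * g - 4 * s) ^+ 2 / e by rewrite divr_ge0 ?sqr_ge0 ?ltW.
have : 16 * s ^+ 2 / e <= 16 * r ^+ 2 / e by rewrite ler_pM2r ?invr_gt0 // ler_pM2l.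
by lra.
Qed.

Lemma barrier_unbounded (A r d M : R) : 0 < A -> 0 <= d < r ->
  exists s, [/\ d < s, s < r & M < barrier A r s].
Proof.
move=> A0 /andP[d0 dr].
pose M1 := `|M| + 1.
have M0 : 0 < M1 by rewrite /M1 ltr_wpDl.
(* The witness is the point with gap [g], where the barrier is [A / g ^+ 2]. The first bound places
   it beyond [d]; the other two give [g ^+ 2 <= g <= A / M1]. *)
pose g := Num.min ((r ^+ 2 - d ^+ 2) / 2) (Num.min 1 (A / M1)).
have rd : d ^+ 2 < r ^+ 2 by rewrite ltr_pXn2r ?nnegrE ?(ltW (le_lt_trans d0 dr)).
have g0 : 0 < g by rewrite !lt_min ltr01 (divr_gt0 A0 M0) !andbT; lra.
have g1 : g <= (r ^+ 2 - d ^+ 2) / 2 by rewrite ge_min lexx.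
have g2 : g <= 1 by rewrite !ge_min lexx orbT.
have g3 : g <= A / M1 by rewrite !ge_min lexx !orbT.
have Q0 : 0 <= r ^+ 2 - g by have := sqr_ge0 d; lra.
have r0 : 0 <= r by lra.
exists (Num.sqrt (r ^+ 2 - g)); split.
- rewrite -(ger0_norm d0) -sqrtr_sqr ltr_sqrt; first by lra.
  by have := sqr_ge0 d; lra.
- rewrite -{2}(ger0_norm r0) -sqrtr_sqr ltr_sqrt; first by lra.
  by have := sqr_ge0 d; lra.
rewrite /barrier sqr_sqrtr // opprB addrC subrK.
apply: le_lt_trans (ler_norm M) _.
apply: (@lt_le_trans _ _ M1); first by rewrite /M1 ltrDl.
rewrite ler_pdivlMr ?exprn_gt0 //.
move: g3; rewrite ler_pdivlMr // => g3.
by apply: le_trans g3; rewrite mulrC ler_pM2r // expr2 ger_pMl.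
Qed.

End Barriers.

(** * Algebraic core *)

Section Algebra.
Context {R : realType}.
Local Set Implicit Arguments.
Local Unset Strict Implicit.
Local Unset Printing Implicit Defensive.

(** Cauchy-Schwarz, read off from the squared deviations from the mean. It bounds the squares of the
    pure second derivatives below by the squared Laplacian over [n]. *)
Lemma sum_sqr_ge n (s : 'I_n -> R) : (0 < n)%N ->
  (\sum_i s i) ^+ 2 / n%:R <= \sum_i s i ^+ 2.
Proof.
move=> n0; set S := \sum_i s i.
have N0 : 0 < n%:R :> R by rewrite ltr0n.
have : 0 <= \sum_i (s i - S / n%:R) ^+ 2 by apply: sumr_ge0 => i _; exact: sqr_ge0.
have -> : \sum_i (s i - S / n%:R) ^+ 2 = \sum_i s i ^+ 2 - S ^+ 2 / n%:R.
  transitivity (\sum_i (s i ^+ 2 + (- 2 * S / n%:R) * s i + S ^+ 2 / n%:R ^+ 2)).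
    by apply: eq_bigr => i _; field; rewrite gt_eqF.
  rewrite !big_split /= -mulr_sumr sumr_const card_ord -mulr_natr -/S.
  by field; rewrite gt_eqF.
by rewrite subr_ge0.
Qed.

Lemma sum_sqr_le n (k : 'I_n -> R) : (forall i, 0 <= k i) ->
  \sum_i k i ^+ 2 <= (\sum_i k i) ^+ 2.
Proof.
move=> k0; rewrite [leRHS]expr2 mulr_suml; apply: ler_sum => i _.
rewrite expr2 ler_wpM2l // (bigD1 i) //= lerDl sumr_ge0 //.
Qed.

Lemma sum_mul_le n (k q : 'I_n -> R) : (forall i, 0 <= k i) ->
  (forall i, 0 <= q i) -> \sum_i k i * q i <= (\sum_i k i) * (\sum_i q i).
Proof.
move=> k0 q0; rewrite mulr_suml; apply: ler_sum => i _.
rewrite ler_wpM2l // (bigD1 i) //= lerDl sumr_ge0 //.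
Qed.

(* The quadratic in [w] is nonnegative because its discriminant is controlled
   by the Riccati equation satisfied by [rate]; the factor [1 + tau] leaves
   room for the error terms. *)
Lemma reaction_ineq (N a tau psi Psi w : R) : 1 <= N -> 0 < a -> 0 < tau ->
  tau <= 1 / 2 -> a <= psi -> (1 + tau) * psi <= Psi -> 0 <= w ->
  N * tau / 2 * Psi ^+ 2 <=
  2 * (1 - tau / 8) / N * (w - N * Psi) ^+ 2 + 2 * w * N * Psi - 2 * a * w
  + N * (1 + tau) * ((a ^+ 2 + 2 * a * psi - 3 * psi ^+ 2) / 2).
Proof.
move=> N1 a0 t0 t1 ap pP w0.
set kap := 1 - tau / 8.
have k1 : 15 / 16 <= kap by rewrite /kap; lra.
have k2 : kap <= 1 by rewrite /kap; lra.
have k3 : tau = 8 * (1 - kap) by rewrite /kap; lra.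
set q := (1 + tau) * ((a ^+ 2 + 2 * a * psi - 3 * psi ^+ 2) / 2).
have P0 : a <= Psi by nra.
(* The discriminant bound in its worst case [N = 1], with [tau * Psi ^+ 2] to spare. [H4] gains
   twice this amount, and [H3] spends half of it on the loss from 4 to [4 * kap ^+ 2]. *)
have disc : tau * Psi ^+ 2 <= 4 * kap ^+ 2 * Psi ^+ 2 + 2 * kap * q - (a + (2 * kap - 1) * Psi) ^+ 2.
  have q0 : q <= 0.
    rewrite /q; have : a ^+ 2 + 2 * a * psi - 3 * psi ^+ 2 <= 0 by nra.
    by nra.
  have H1 : 2 * q <= 2 * kap * q by nra.
  have H2 : (a + (2 * kap - 1) * Psi) ^+ 2 <= (a + Psi) ^+ 2.
    by rewrite ler_pXn2r ?nnegrE //; nra.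
  have H3 : 4 * Psi ^+ 2 - tau * Psi ^+ 2 <= 4 * kap ^+ 2 * Psi ^+ 2.
    rewrite -mulrBl ler_wpM2r ?sqr_ge0 //.
    by have := sqr_ge0 tau; rewrite /kap; lra.
  (* The Riccati right-hand side enters here. With [Th = (1 + tau) * psi], everything on the right
     at [Psi = Th] cancels except [tau * a ^+ 2 + 3 * Th * (tau * psi)]; [F2] and [F3] pass from
     [Th] to a larger [Psi]. *)
  have H4 : 2 * tau * Psi ^+ 2 <= 3 * Psi ^+ 2 - 2 * a * Psi - a ^+ 2 + 2 * q.
    have E : 2 * q = (1 + tau) * a ^+ 2 + 2 * a * ((1 + tau) * psi) - 3 * ((1 + tau) * psi) * psi.
      by rewrite /q; field.
    have Th0 : a <= (1 + tau) * psi by nra.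
    set Th := (1 + tau) * psi in pP E Th0 *.
    have pE : 3 * Th * psi = 3 * Th ^+ 2 - 3 * Th * (tau * psi) by rewrite /Th; ring.
    have tp : 2 / 3 * tau * Th <= tau * psi.
      have : 0 <= (1 - 2 * tau) * (tau * psi) by rewrite !mulr_ge0 //; lra.
      by rewrite /Th; lra.
    have F1 : 2 * tau * Th ^+ 2 <= 3 * Th * (tau * psi).
      have : 0 <= 3 * Th * (tau * psi - 2 / 3 * tau * Th) by rewrite mulr_ge0 //; lra.
      by lra.
    have F2 : Psi ^+ 2 - Th ^+ 2 <= 3 * Psi ^+ 2 - 3 * Th ^+ 2 - 2 * a * (Psi - Th).
      suff : 0 <= (Psi - Th) * (2 * (Psi + Th) - 2 * a) by nra.
      by apply: mulr_ge0; lra.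
    have F3 : 2 * tau * (Psi ^+ 2 - Th ^+ 2) <= Psi ^+ 2 - Th ^+ 2.
      have PT2 : 0 <= Psi ^+ 2 - Th ^+ 2.
        by rewrite subr_ge0 ler_pXn2r ?nnegrE //; lra.
      have : 0 <= (1 - 2 * tau) * (Psi ^+ 2 - Th ^+ 2) by rewrite mulr_ge0 //; lra.
      by lra.
    have : 0 <= tau * a ^+ 2 by rewrite mulr_ge0 ?sqr_ge0 ?ltW.
    by lra.
  by lra.
have N0 : 0 < N by lra.
have kN : 0 < N / (2 * kap) by rewrite divr_gt0 //; lra.
have knz : kap != 0 by apply: lt0r_neq0; lra.
have Nnz : N != 0 by apply: lt0r_neq0; lra.
have -> : N * (1 + tau) * ((a ^+ 2 + 2 * a * psi - 3 * psi ^+ 2) / 2) = N * q.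
  by rewrite /q; ring.
have step : N * tau / 2 * Psi ^+ 2 <= N / (2 * kap) * (tau * Psi ^+ 2).
  have -> : N * tau / 2 * Psi ^+ 2 = N / (2 * kap) * (kap * (tau * Psi ^+ 2)) by field.
  rewrite ler_pM2l //; have : 0 <= tau * Psi ^+ 2 by rewrite mulr_ge0 ?sqr_ge0 ?ltW.
  by nra.
apply: le_trans step _.
(* The vertex of the quadratic lies at [N / (2 * kap) * (a - (N - 2 * kap) * Psi)]. If it is not
   positive, the minimum over [w >= 0] is at [w = 0]; otherwise one completes the square and
   compares with the case [N = 1]. *)
have [big|small] := lerP a ((N - 2 * kap) * Psi).
  have -> : 2 * kap / N * (w - N * Psi) ^+ 2 + 2 * w * N * Psi - 2 * a * w + N * q
    = 2 * kap / N * w ^+ 2 + 2 * w * ((N - 2 * kap) * Psi - a)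
      + N / (2 * kap) * (4 * kap ^+ 2 * Psi ^+ 2 + 2 * kap * q).
    by field; rewrite knz Nnz.
  apply: ler_wpDl.
    apply: addr_ge0; last by rewrite !mulr_ge0 // subr_ge0.
    by rewrite mulr_ge0 ?sqr_ge0 // divr_ge0 //; lra.
  by rewrite ler_pM2l //; have := sqr_ge0 (a + (2 * kap - 1) * Psi); lra.
have -> : 2 * kap / N * (w - N * Psi) ^+ 2 + 2 * w * N * Psi - 2 * a * w + N * q
  = 2 * kap / N * (w - N / (2 * kap) * (a - (N - 2 * kap) * Psi)) ^+ 2
    + N / (2 * kap) * (4 * kap ^+ 2 * Psi ^+ 2 + 2 * kap * q - (a - (N - 2 * kap) * Psi) ^+ 2).
  by field; rewrite knz Nnz.
apply: ler_wpDl.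
  by apply: mulr_ge0; rewrite ?sqr_ge0 ?divr_ge0 //; lra.
rewrite ler_pM2l //; apply: le_trans disc _.
have NPsi : 0 <= (N - 1) * Psi by rewrite mulr_ge0 //; lra.
have kPsi : 0 <= (2 * kap - 1) * Psi by rewrite mulr_ge0 //; lra.
by rewrite lerB // ler_pXn2r ?nnegrE //; lra.
Qed.

(** The two last hypotheses are the sign of the Harnack quantity and the Bochner inequality at a
    limit of minimum points. [reaction_ineq] leaves [c * (w - S) ^+ 2] with [c = tau / (2 * N)],
    while the sign gives [w - S >= phi + K + beta * X]. Squaring pays for all barrier terms and
    leaves the strictly positive [c * phi ^+ 2]. *)
Lemma limit_contradiction n (a tau psi w phi : R) (s p k k1 k2 : 'I_n -> R) :
  let beta := tau / 8 in
  (0 < n)%N -> 0 < a -> 0 < tau -> tau <= 1 / 2 -> a <= psi -> 0 <= w ->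
  phi = n%:R * ((1 + tau) * psi) ->
  (forall i, 0 <= k i) ->
  (forall i, k2 i + 2 * p i * k1 i <= tau / (2 * n%:R) * k i ^+ 2
     + 2 * beta * (tau / (2 * n%:R)) * k i * p i ^+ 2) ->
  \sum_i s i + beta * \sum_i p i ^+ 2 - w + phi + \sum_i k i <= 0 ->
  2 * (1 - beta) * \sum_i s i ^+ 2 - 2 * w * \sum_i s i
  + (2 - 4 * beta) * w * \sum_i p i ^+ 2 - 2 * a * w + 2 * w ^+ 2
  + n%:R * ((1 + tau) * ((a ^+ 2 + 2 * a * psi - 3 * psi ^+ 2) / 2))
  - \sum_i (k2 i + 2 * p i * k1 i) <= 0 -> False.
Proof.
move=> beta n0 a0 t0 t1 ap w0 phiE k0 kk.
set N : R := n%:R; set S := \sum_i s i; set X := \sum_i p i ^+ 2; set K := \sum_i k i.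
move=> H1 H2.
have N1 : 1 <= N by rewrite ler1n.
have X0 : 0 <= X by apply: sumr_ge0 => i _; exact: sqr_ge0.
have K0 : 0 <= K by apply: sumr_ge0.
have b0 : 0 < beta by rewrite divr_gt0.
have b1 : beta <= 1 / 16 by rewrite /beta; lra.
(* With this choice the quadratic of [reaction_ineq] has [w - N * Psi] equal to the Laplacian
   [S]. *)
pose Psi := (w - S) / N.
have NP : N * Psi = w - S by rewrite /Psi mulrC divfK // gt_eqF //; lra.
have PT : (1 + tau) * psi <= Psi.
  rewrite /Psi ler_pdivlMr; last by lra.
  rewrite mulrC -phiE; have : 0 <= beta * X by rewrite mulr_ge0 // ltW.
  by lra.
have := reaction_ineq N1 a0 t0 t1 ap PT w0.
have := sum_sqr_ge s n0; rewrite -/S -/N => CS.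
rewrite -/beta NP -[2 * w * N * Psi]mulrA NP.
have -> : w - (w - S) = S by ring.
move=> RI.
pose c := tau / (2 * N).
have c0 : 0 < c by rewrite divr_gt0 //; lra.
have CS2 : 2 * (1 - beta) / N * S ^+ 2 <= 2 * (1 - beta) * \sum_i s i ^+ 2.
  rewrite -[2 * (1 - beta) / N * _]mulrA ler_pM2l; last by lra.
  by rewrite mulrC.
have W : 0 <= (2 - 4 * beta) * w * X by rewrite !mulr_ge0 //; lra.
have phi0 : 0 < phi by rewrite phiE -/N !mulr_gt0 //; lra.
have E : N * tau / 2 * Psi ^+ 2 = c * (w - S) ^+ 2.
  by rewrite -NP /c; field; rewrite gt_eqF //; lra.
have BK : \sum_i (k2 i + 2 * p i * k1 i) <= c * K ^+ 2 + 2 * beta * c * (K * X).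
  apply: (@le_trans _ _ (\sum_i (c * k i ^+ 2 + 2 * beta * c * (k i * p i ^+ 2)))).
    by apply: ler_sum => i _; rewrite [_ * (k i * _)]mulrA; exact: kk.
  rewrite big_split /= -!mulr_sumr lerD // ler_wpM2l ?sum_sqr_le ?sum_mul_le //.
  - exact: ltW.
  - by apply: mulr_ge0; [apply: mulr_ge0|]; rewrite ?(ltW b0) ?(ltW c0).
  - by move=> i; exact: sqr_ge0.
have Q : phi ^+ 2 + K ^+ 2 + 2 * beta * (K * X) <= (w - S) ^+ 2.
  have bX : 0 <= beta * X by rewrite mulr_ge0 // ltW.
  apply: (@le_trans _ _ ((phi + K + beta * X) ^+ 2)).
    have : 0 <= phi * K by rewrite mulr_ge0 // ltW.
    have : 0 <= phi * (beta * X) by rewrite mulr_ge0 // ltW.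
    have := sqr_ge0 (beta * X).
    by lra.
  by rewrite ler_pXn2r ?nnegrE //; lra.
have Q' : c * phi ^+ 2 + c * K ^+ 2 + 2 * beta * c * (K * X) <= c * (w - S) ^+ 2.
  have -> : c * phi ^+ 2 + c * K ^+ 2 + 2 * beta * c * (K * X) =
    c * (phi ^+ 2 + K ^+ 2 + 2 * beta * (K * X)) by ring.
  by rewrite ler_pM2l.
have : 0 < c * phi ^+ 2 by rewrite mulr_gt0 // exprn_gt0.
move: RI H2; rewrite -/N -/S -/X E.
have -> : n%:R * ((1 + tau) * ((a ^+ 2 + 2 * a * psi - 3 * psi ^+ 2) / 2)) =
  N * (1 + tau) * ((a ^+ 2 + 2 * a * psi - 3 * psi ^+ 2) / 2) by rewrite mulrA.
by lra.
Qed.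

(* Subtracting from the time derivative the Laplacian and the transport term
   [2 <grad u, grad .>], the third-order terms cancel because
   [x^2 - y^2 - 2 y (x - y) = (x - y)^2]. *)
Lemma discrete_bochner n (a beta h w phi' T0 : R)
  (Tp Tm wp wm g p s k1 k2 : 'I_n -> R) (pp pm sp sm : 'I_n -> 'I_n -> R) :
  0 < h -> 0 < beta -> beta <= 1 / 16 -> (forall i, `|g i * h| <= 1 / 2) ->
  T0 = \sum_j (s j + p j ^+ 2) + a - w ->
  (forall i, Tp i = \sum_j (sp i j + pp i j ^+ 2) + a - wp i) ->
  (forall i, Tm i = \sum_j (sm i j + pm i j ^+ 2) + a - wm i) ->
  (forall j, \sum_i (pp i j + pm i j - 2 * p j) / h ^+ 2
     + beta * \sum_i 2 * g i * ((pp i j - p j) / h) - 2 * w * p j + k1 j = 0) ->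
  (forall j, 0 <= \sum_i (sp i j + sm i j - 2 * s j) / h ^+ 2
     + beta * \sum_i (2 * ((pp i j - p j) / h) ^+ 2 + 2 * g i * ((sp i j - s j) / h))
     - w * (2 * s j + 4 * p j ^+ 2) + k2 j) ->
  \sum_i (Tp i + Tm i - 2 * T0) / h ^+ 2
     + beta * \sum_i 2 * g i * ((Tp i - T0) / h) - 2 * w * T0 + phi' <= 0 ->
  \sum_i ((1 - 2 * beta + 2 * beta * (g i * h)) * ((pp i i - p i) / h) ^+ 2
          + ((pm i i - p i) / h) ^+ 2)
  - \sum_i (wp i + wm i - 2 * w) / h ^+ 2
  - 2 * beta * \sum_i g i * ((wp i - w) / h)
  - 2 * w * (a - w) + 6 * w * \sum_i p i ^+ 2 + phi'
  - \sum_i (k2 i + 2 * p i * k1 i) <= 0.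
Proof.
move=> h0 b0 b1 gh ET0 ETp ETm D1 D2 D3.
have hn : h != 0 by rewrite gt_eqF.
(* The squared difference quotients produced by [Q], a discrete Hessian norm. The weight is positive
   because [beta <= 1 / 16] and [|g i * h| <= 1 / 2], so the off-diagonal terms may be dropped. *)
pose Q i j := (1 - 2 * beta + 2 * beta * (g i * h)) * ((pp i j - p j) / h) ^+ 2
          + ((pm i j - p j) / h) ^+ 2.
have Q0 i j : 0 <= Q i j.
  apply: addr_ge0; last exact: sqr_ge0.
  apply: mulr_ge0; last exact: sqr_ge0.
  have := gh i; rewrite ler_norml => /andP[? ?]; nra.
have diag : \sum_i Q i i <= \sum_i \sum_j Q i j.
  by apply: ler_sum => i _; rewrite (bigD1 i) //= lerDl sumr_ge0.
(* The nonnegative second derivative in direction [j], plus [2 * p j] times the vanishing first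
   derivative: the Laplacian and transport terms of the minimised quantity. *)
pose Z j := \sum_i (sp i j + sm i j - 2 * s j) / h ^+ 2
     + beta * \sum_i (2 * ((pp i j - p j) / h) ^+ 2 + 2 * g i * ((sp i j - s j) / h))
     - w * (2 * s j + 4 * p j ^+ 2) + k2 j
     + 2 * p j * (\sum_i (pp i j + pm i j - 2 * p j) / h ^+ 2
     + beta * \sum_i 2 * g i * ((pp i j - p j) / h) - 2 * w * p j + k1 j).
have Z0 : 0 <= \sum_j Z j.
  by apply: sumr_ge0 => j _; rewrite /Z D1 mulr0 addr0.
pose V i j := (sp i j + sm i j - 2 * s j) / h ^+ 2
  + beta * (2 * ((pp i j - p j) / h) ^+ 2 + 2 * g i * ((sp i j - s j) / h))
  + 2 * p j * ((pp i j + pm i j - 2 * p j) / h ^+ 2 + beta * (2 * g i * ((pp i j - p j) / h))).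
have ZV : \sum_j Z j = \sum_i \sum_j V i j
   + \sum_j (- w * (2 * s j + 4 * p j ^+ 2) - 4 * w * p j ^+ 2 + (k2 j + 2 * p j * k1 j)).
  rewrite exchange_big -big_split /=; apply: eq_bigr => j _.
  have -> : \sum_i V i j = \sum_i (sp i j + sm i j - 2 * s j) / h ^+ 2
    + beta * \sum_i (2 * ((pp i j - p j) / h) ^+ 2 + 2 * g i * ((sp i j - s j) / h))
    + 2 * p j * (\sum_i (pp i j + pm i j - 2 * p j) / h ^+ 2
                 + beta * \sum_i 2 * g i * ((pp i j - p j) / h)).
    rewrite [2 * p j * (_ + _)]mulrDr !mulr_sumr -!big_split /=.
    by apply: eq_bigr => i _; rewrite /V; ring.
  by rewrite /Z; ring.
have TQ : \sum_i (Tp i + Tm i - 2 * T0) / h ^+ 2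
     + beta * \sum_i 2 * g i * ((Tp i - T0) / h) =
   \sum_i \sum_j (Q i j + V i j) - \sum_i (wp i + wm i - 2 * w) / h ^+ 2
  - 2 * beta * \sum_i g i * ((wp i - w) / h).
  rewrite !mulr_sumr -!sumrB -big_split /=; apply: eq_bigr => i _.
  rewrite ETp ETm ET0.
  have -> : \sum_j (Q i j + V i j) =
    ((\sum_j (sp i j + pp i j ^+ 2)) + (\sum_j (sm i j + pm i j ^+ 2))
      - 2 * \sum_j (s j + p j ^+ 2)) / h ^+ 2
    + 2 * beta * g i / h * (\sum_j (sp i j + pp i j ^+ 2) - \sum_j (s j + p j ^+ 2)).
    rewrite mulr_sumr -sumrB -big_split /= -sumrB mulr_suml mulr_sumr -big_split /=.
    by apply: eq_bigr => j _; rewrite /Q /V; field.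
  by field.
have WE : \sum_j (- w * (2 * s j + 4 * p j ^+ 2) - 4 * w * p j ^+ 2 + (k2 j + 2 * p j * k1 j))
  = - 2 * w * \sum_j s j - 8 * w * \sum_j p j ^+ 2 + \sum_j (k2 j + 2 * p j * k1 j).
  rewrite [RHS]addrC !mulr_sumr -sumrB -big_split /=; apply: eq_bigr => j _; ring.
have QV : \sum_i \sum_j (Q i j + V i j) = \sum_i \sum_j Q i j + \sum_i \sum_j V i j.
  by rewrite -big_split; apply: eq_bigr => i _; rewrite -big_split.
have wT : w * T0 = w * \sum_j s j + w * \sum_j p j ^+ 2 + w * a - w ^+ 2.
  by rewrite ET0 big_split /=; ring.
move: D3 Z0; rewrite TQ ZV WE QV -[2 * w * T0]mulrA wT.
rewrite -/(Q _ _) in diag *.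
move: diag; rewrite /Q; lra.
Qed.

End Algebra.

(** * Directional derivatives, minimum points and compactness *)

Section Limits.
Context {R : realType} {T : Type} {F : set_system T} {FF : Filter F}.
Local Set Implicit Arguments.
Local Unset Strict Implicit.
Local Unset Printing Implicit Defensive.
Implicit Types f g : T -> R.

Lemma cvgD_fun f g (a b : R) : f x @[x --> F] --> a -> g x @[x --> F] --> b ->
  (f x + g x) @[x --> F] --> a + b.
Proof. exact: cvgD. Qed.

Lemma cvgB_fun f g (a b : R) : f x @[x --> F] --> a -> g x @[x --> F] --> b ->
  (f x - g x) @[x --> F] --> a - b.
Proof. exact: cvgB. Qed.

Lemma cvgM_fun f g (a b : R) : f x @[x --> F] --> a -> g x @[x --> F] --> b ->
  (f x * g x) @[x --> F] --> a * b.
Proof. exact: cvgM. Qed.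

Lemma cvgZ_fun (c : R) f (a : R) : f x @[x --> F] --> a ->
  (c * f x) @[x --> F] --> c * a.
Proof. by apply: cvgM_fun; exact: cvg_cst. Qed.

Lemma cvg_sqr_fun f (a : R) : f x @[x --> F] --> a ->
  (f x ^+ 2) @[x --> F] --> a ^+ 2.
Proof.
move=> H; rewrite expr2 (_ : (fun x => _) = fun x => f x * f x); first exact: cvgM_fun.
by apply/funext => x; rewrite expr2.
Qed.

Lemma cvg_sum_fun n (f : 'I_n -> T -> R) (a : 'I_n -> R) :
  (forall i, f i x @[x --> F] --> a i) ->
  (\sum_i f i x) @[x --> F] --> \sum_i a i.
Proof. by move=> H; apply: cvg_big => //; exact: add_continuous. Qed.

Lemma cvg_has_derive (G : R -> R) f (a d : R) : has_derive G a d ->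
  f x @[x --> F] --> a -> G (f x) @[x --> F] --> G a.
Proof.
move=> [D _]; apply: continuous_cvg.
exact/differentiable_continuous/derivable1_diffP.
Qed.

End Limits.

(** * Derivatives along coordinate lines and limits of difference quotients *)

Section Lines.
Context {R : realType} {n : nat}.
Local Set Implicit Arguments.
Local Unset Strict Implicit.
Local Unset Printing Implicit Defensive.
Implicit Types (G dG : 'rV[R]_n -> R -> R) (i j : 'I_n).

Definition basis_vec i : 'rV[R]_n := delta_mx 0 i.
Local Notation e := basis_vec.

(** Asking for the derivative at parameter 0 suffices, since the base point is arbitrary and can be
    translated along the line. *)
Definition line_derive i G dG := forall x t, 0 < t ->
  has_derive (fun r => G (x + r *: e i) t) 0 (dG x t).

Lemma line_deriveP i G dG : line_derive i G dG -> forall x v t r, 0 < t ->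
  has_derive (fun s => G (x + s *: e i + v) t) r (dG (x + r *: e i + v) t).
Proof.
move=> H x v t r t0.
have H0 : has_derive (fun s => G (x + r *: e i + v + s *: e i) t) (r - r) (dG (x + r *: e i + v) t).
  by rewrite subrr; exact: H.
apply: (has_derive_ext (has_derive_shift H0)) => // s /=.
congr (G _ t); rewrite [RHS]addrAC; congr (_ + v).
by rewrite -addrA -scalerDl [r + _]addrC subrK.
Qed.

Lemma line_deriveP0 i G dG : line_derive i G dG -> forall x t r, 0 < t ->
  has_derive (fun s => G (x + s *: e i) t) r (dG (x + r *: e i) t).
Proof.
move=> H x t r t0; have := line_deriveP H x 0 r t0; rewrite addr0 => H0.
by apply: (has_derive_ext H0) => // s /=; rewrite addr0.
Qed.

Lemma line_mvt i G dG h x t : line_derive i G dG -> 0 < t -> 0 < h ->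
  exists2 c, `|c| <= h & (G (x + h *: e i) t - G x t) / h = dG (x + c *: e i) t.
Proof.
move=> H t0 h0.
have [r _|c /andP[c0 ch]] := @mvt _ (fun s => G (x + s *: e i) t)
  (fun s => dG (x + s *: e i) t) 0 h h0.
  exact: line_deriveP0.
rewrite scale0r addr0 subr0 => E; exists c; first by rewrite gtr0_norm // ltW.
by rewrite E mulfK // gt_eqF.
Qed.

Lemma line_mvtN i G dG h x t : line_derive i G dG -> 0 < t -> 0 < h ->
  exists2 c, `|c| <= h & (G (x - h *: e i) t - G x t) / h = - dG (x + c *: e i) t.
Proof.
move=> H t0 h0; have h0' : - h < 0 by rewrite oppr_lt0.
have [r _|c /andP[c0 ch]] := @mvt _ (fun s => G (x + s *: e i) t)
  (fun s => dG (x + s *: e i) t) (- h) 0 h0'.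
  exact: line_deriveP0.
rewrite scale0r addr0 scaleNr sub0r opprK => E.
exists c; first by rewrite ltr0_norm // lerNl ltW.
by rewrite -opprB E mulNr mulfK // gt_eqF.
Qed.

Lemma line_mvt2 i G dG ddG h x t : line_derive i G dG -> line_derive i dG ddG ->
  0 < t -> 0 < h ->
  exists2 c, `|c| <= h &
    (G (x + h *: e i) t + G (x - h *: e i) t - 2 * G x t) / h ^+ 2 = ddG (x + c *: e i) t.
Proof.
move=> H H' t0 h0.
have [r _|r _|c ch] := @second_difference _ (fun s => G (x + s *: e i) t)
  (fun s => dG (x + s *: e i) t) (fun s => ddG (x + s *: e i) t) h h0.
- exact: line_deriveP0.
- exact: line_deriveP0.
rewrite scale0r addr0 scaleNr => E; exists c => //.
by rewrite E mulrAC mulfV ?mul1r // expf_neq0 // gt_eqF.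
Qed.

Lemma joint_cvg (T : Type) (F : set_system T) (FF : Filter F) G
    (x : T -> 'rV[R]_n) (t : T -> R) (xs : 'rV[R]_n) (ts : R) : 0 < ts -> jointly_continuous G ->
  x y @[y --> F] --> xs -> t y @[y --> F] --> ts ->
  G (x y) (t y) @[y --> F] --> G xs ts.
Proof.
move=> t0 H Hx Ht.
have C : (x y, t y) @[y --> F] --> (xs, ts) by apply: (@cvg_pair _ _ _ F (nbhs xs) (nbhs ts)).
exact: (cvg_comp _ _ C (H xs ts t0)).
Qed.

(** The bridge from mean value theorems to limits: a quotient equal to [G] at an intermediate point
    within [h y] of a moving base point converges to [G] at the limit point, by squeezing. *)
Lemma joint_cvg_near (T : Type) (F : set_system T) (FF : Filter F) G
    (x : T -> 'rV[R]_n) (t h Q : T -> R) (xs : 'rV[R]_n) (ts : R) i : 0 < ts -> jointly_continuous G ->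
  x y @[y --> F] --> xs -> t y @[y --> F] --> ts -> h y @[y --> F] --> (0 : R) ->
  (\forall y \near F, exists2 c, `|c| <= h y & Q y = G (x y + c *: e i) (t y)) ->
  Q y @[y --> F] --> G xs ts.
Proof.
move=> t0 H Hx Ht Hh HQ.
pose P y c := `|c| <= h y /\ Q y = G (x y + c *: e i) (t y).
(* Intermediate points are selected for all [y] at once; the default 0 is taken only where none
   exists, which does not occur near [F]. *)
have [c cP] : {c : T -> R & forall y, (exists c, P y c) -> P y (c y)}.
  apply: (@choice T R (fun y c => (exists c, P y c) -> P y c)) => y.
  have [[c0 Pc]|nP] := pselect (exists c, P y c); first by exists c0.
  by exists 0.
have HP : \forall y \near F, P y (c y).
  by apply: filterS HQ => y [c0 c1 c2]; apply: cP; exists c0.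
have Hc : c y @[y --> F] --> (0 : R).
  apply: (@squeeze_cvgr _ _ _ _ (fun y => - h y) h) => //.
    by apply: filterS HP => y [/ler_normlP[? ?] _]; apply/andP; split => //; rewrite lerNl.
  by rewrite -[0]oppr0; exact: cvgN.
have HG : G (x y + c y *: e i) (t y) @[y --> F] --> G xs ts.
  apply: joint_cvg => //.
  rewrite -[xs]addr0 -[0](scale0r (e i)); apply: cvgD => //.
  exact: cvgZr_tmp.
apply: cvg_trans HG; apply: near_eq_cvg.
by apply: filterS HP => y [_ ->].
Qed.

Lemma coord_cvg (T : Type) (F : set_system T) (FF : Filter F)
    (x : T -> 'rV[R]_n) (xs : 'rV[R]_n) i :
  x y @[y --> F] --> xs -> x y 0 i @[y --> F] --> xs 0 i.
Proof.
by move=> H; exact: (cvg_comp _ _ H (@coord_continuous R 1 n 0 i xs)).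
Qed.

End Lines.

(** * The discretised Harnack quantity and its minimum points *)

Section MinimumPoint.
Context {R : realType} {n : nat}.
Local Set Implicit Arguments.
Local Unset Strict Implicit.
Local Unset Printing Implicit Defensive.
Local Notation e := (@basis_vec R n).
Implicit Types (x : 'rV[R]_n) (t h r : R).

(** The properties of [u = ln f] used below, with the derivatives as explicit functions: [p i] is
    the gradient component and [s i] the pure second derivative. *)
Record log_solution (a b : R) (u ut : 'rV[R]_n -> R -> R)
    (p s : 'I_n -> 'rV[R]_n -> R -> R) : Prop := LogSolution {
  log_dt : forall x t, 0 < t -> has_derive (u x) t (ut x t);
  log_dx : forall i, line_derive i u (p i);
  log_dxx : forall i, line_derive i (p i) (s i);
  log_cont : jointly_continuous u;
  log_dx_cont : forall i, jointly_continuous (p i);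
  log_dxx_cont : forall i, jointly_continuous (s i);
  log_eq : forall x t, 0 < t ->
    ut x t = \sum_i (s i x t + p i x t ^+ 2) + a - b * expR (2 * u x t) }.

Context (a b : R) (u ut : 'rV[R]_n -> R -> R) (p s : 'I_n -> 'rV[R]_n -> R -> R).
Hypothesis Hu : log_solution a b u ut p s.
Context (beta : R) (phi k k1 k2 : R -> R).

Definition reaction x t : R := b * expR (2 * u x t).
Local Notation w := reaction.

Definition quot h x t i : R := (u (x + h *: e i) t - u x t) / h.

(* Difference-quotient form of
   [Lap u + beta |grad u|^2 - w + phi + sum_i k(x_i)]; only first derivatives in
   time and pure second derivatives in space of [u] are needed to differentiate it. *)
Definition harnack h x t : R :=
  \sum_i (u (x + h *: e i) t + u (x - h *: e i) t - 2 * u x t) / h ^+ 2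
  + beta * \sum_i quot h x t i ^+ 2 - w x t + phi t + \sum_i k (x 0 i).

Definition harnack_dx j h x t : R :=
  \sum_i (p j (x + h *: e i) t + p j (x - h *: e i) t - 2 * p j x t) / h ^+ 2
  + beta * \sum_i 2 * quot h x t i * ((p j (x + h *: e i) t - p j x t) / h)
  - 2 * w x t * p j x t + k1 (x 0 j).

Definition harnack_dxx j h x t : R :=
  \sum_i (s j (x + h *: e i) t + s j (x - h *: e i) t - 2 * s j x t) / h ^+ 2
  + beta * \sum_i (2 * ((p j (x + h *: e i) t - p j x t) / h) ^+ 2
                   + 2 * quot h x t i * ((s j (x + h *: e i) t - s j x t) / h))
  - w x t * (2 * s j x t + 4 * p j x t ^+ 2) + k2 (x 0 j).

Definition harnack_dt phi1 h x t : R :=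
  \sum_i (ut (x + h *: e i) t + ut (x - h *: e i) t - 2 * ut x t) / h ^+ 2
  + beta * \sum_i 2 * quot h x t i * ((ut (x + h *: e i) t - ut x t) / h)
  - 2 * w x t * ut x t + phi1.

Lemma has_derive_divr (F : R -> R) r dF c :
  has_derive F r dF -> has_derive (fun s => F s / c) r (dF / c).
Proof.
move=> H; apply: (has_derive_eq (has_deriveM H (has_derive_cst _ _))).
by rewrite mulr0 addr0.
Qed.

(** [U], [Up] and [Um] stand for [u] at the centre and at the shifted points along an arbitrary
    curve, so one computation serves both the space and the time derivatives. *)
Lemma has_derive_quot_sum h (U : R -> R) (Up Um : 'I_n -> R -> R) dU
    (dUp dUm : 'I_n -> R) r :
  has_derive U r dU -> (forall i, has_derive (Up i) r (dUp i)) ->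
  (forall i, has_derive (Um i) r (dUm i)) ->
  has_derive (fun y => \sum_i (Up i y + Um i y - 2 * U y) / h ^+ 2
     + beta * \sum_i ((Up i y - U y) / h) ^+ 2 - b * expR (2 * U y)) r
    (\sum_i (dUp i + dUm i - 2 * dU) / h ^+ 2
     + beta * \sum_i 2 * ((Up i r - U r) / h) * ((dUp i - dU) / h)
     - 2 * (b * expR (2 * U r)) * dU).
Proof.
move=> HU Hp Hm; apply: has_derive_eq.
  apply: has_deriveB; first apply: has_deriveD.
  - apply: has_derive_sum => i; apply: has_derive_divr; apply: has_deriveB.
      exact: has_deriveD (Hp i) (Hm i).
    exact: has_deriveZ HU.
  - apply: has_deriveZ; apply: has_derive_sum => i; apply: has_derive_sqr.
    by apply: has_derive_divr; exact: has_deriveB (Hp i) HU.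
  - by apply: has_deriveZ; apply: has_derive_expR; exact: has_deriveZ HU.
by congr (_ - _); ring.
Qed.

Lemma has_derive_coord_sum (K dK : R -> R) x j r :
  has_derive K ((x + r *: e j) 0 j) (dK ((x + r *: e j) 0 j)) ->
  has_derive (fun y => \sum_i K ((x + y *: e j) 0 i)) r (dK ((x + r *: e j) 0 j)).
Proof.
move=> H.
have E i y : (x + y *: e j) 0 i = if i == j then y + x 0 j else x 0 i.
  rewrite !mxE eqxx /=; have [->|ij] := eqVneq i j; first by rewrite mulr1 addrC.
  by rewrite mulr0 addr0.
rewrite [dK _](_ : _ = \sum_i (if i == j then dK ((x + r *: e j) 0 j) else 0)); last first.
  by rewrite -big_mkcond big_pred1_eq.
apply: has_derive_sum => i; have [->|ij] := eqVneq i j.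
  have H' : has_derive K (r + x 0 j) (dK ((x + r *: e j) 0 j)).
    by move: H; rewrite {1}E eqxx.
  by apply: (has_derive_ext (has_derive_shift H')) => // y; rewrite E eqxx.
apply: (has_derive_ext (has_derive_cst (K (x 0 i)) r)) => // y.
by rewrite E (negbTE ij).
Qed.

Lemma has_derive_harnack h x t j r : 0 < t ->
  has_derive k ((x + r *: e j) 0 j) (k1 ((x + r *: e j) 0 j)) ->
  has_derive (fun y => harnack h (x + y *: e j) t) r (harnack_dx j h (x + r *: e j) t).
Proof.
move=> t0 Hk.
apply: has_deriveD; last exact: has_derive_coord_sum.
rewrite -[X in has_derive _ _ X]addr0; apply: has_deriveD; last exact: has_derive_cst.
have L := log_dx Hu j.
exact: (has_derive_quot_sum h (line_deriveP0 L x r t0)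
  (fun i => line_deriveP L x (h *: e i) r t0)
  (fun i => line_deriveP L x (- (h *: e i)) r t0)).
Qed.

Lemma has_derive_harnack_dx h x t j : 0 < t ->
  has_derive k1 (x 0 j) (k2 (x 0 j)) ->
  has_derive (fun y => harnack_dx j h (x + y *: e j) t) 0 (harnack_dxx j h x t).
Proof.
move=> t0 Hk.
have L := log_dx Hu j; have L2 := log_dxx Hu j.
have x0 : x + 0 *: e j = x by rewrite scale0r addr0.
have U0 := line_deriveP0 L x 0 t0.
have U v := line_deriveP L x v 0 t0.
have P0 := line_deriveP0 L2 x 0 t0.
have P v := line_deriveP L2 x v 0 t0.
apply: has_derive_eq.
  apply: has_deriveD; first apply: has_deriveB; first apply: has_deriveD.
  - apply: has_derive_sum => i; apply: has_derive_divr; apply: has_deriveB.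
      by apply: has_deriveD; exact: P.
    by apply: has_deriveZ; exact: P0.
  - apply: has_deriveZ; apply: has_derive_sum => i; apply: has_deriveM.
      apply: has_deriveZ; apply: has_derive_divr; apply: has_deriveB; [exact: U|exact: U0].
    by apply: has_derive_divr; apply: has_deriveB; [exact: P|exact: P0].
  - apply: has_deriveM; last exact: P0.
    by apply: has_deriveZ; apply: has_deriveZ; apply: has_derive_expR; apply: has_deriveZ; exact: U0.
  - have H : has_derive (fun y => k1 (y + x 0 j)) 0 (k2 (x 0 j)).
      by apply: has_derive_shift; rewrite add0r.
    apply: (has_derive_ext H) => // y.
    by rewrite !mxE !eqxx mulr1 addrC.
rewrite !x0 /harnack_dxx /w; congr (_ + _); congr (_ - _); last by ring.
congr (_ + _); congr (_ * _); apply: eq_bigr => i _.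
by ring.
Qed.

Lemma has_derive_harnack_dt h x t phi1 : 0 < t -> has_derive phi t phi1 ->
  has_derive (harnack h x) t (harnack_dt phi1 h x t).
Proof.
move=> t0 Hphi.
rewrite -[X in has_derive _ _ X]addr0.
apply: has_deriveD; last exact: has_derive_cst.
apply: has_deriveD => //.
exact: (has_derive_quot_sum h (log_dt Hu x t0)
  (fun i => log_dt Hu (x + h *: e i) t0) (fun i => log_dt Hu (x - h *: e i) t0)).
Qed.

(** At such a minimum the space derivatives vanish, the pure second ones are nonnegative and the
    time derivative is nonpositive; these are the inputs of [discrete_bochner]. The bound 1/2 on the
    increments of [u] is its condition on [g i * h]. *)
Lemma harnack_min_ineq h x t eps rad phi1 : 0 < t -> 0 < h -> 0 < eps ->
  0 < beta -> beta <= 1 / 16 ->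
  (forall i, `|u (x + h *: e i) t - u x t| <= 1 / 2) ->
  has_derive phi t phi1 ->
  (forall r, `|r| < rad -> has_derive k r (k1 r)) ->
  (forall r, `|r| < rad -> has_derive k1 r (k2 r)) ->
  (forall i, `|x 0 i| < rad) ->
  (forall j r, `|r| < eps -> harnack h x t <= harnack h (x + r *: e j) t) ->
  (forall r, t - eps < r <= t -> harnack h x t <= harnack h x r) ->
  \sum_i ((1 - 2 * beta + 2 * beta * (quot h x t i * h))
            * ((p i (x + h *: e i) t - p i x t) / h) ^+ 2
          + ((p i (x - h *: e i) t - p i x t) / h) ^+ 2)
  - \sum_i (w (x + h *: e i) t + w (x - h *: e i) t - 2 * w x t) / h ^+ 2
  - 2 * beta * \sum_i quot h x t i * ((w (x + h *: e i) t - w x t) / h)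
  - 2 * w x t * (a - w x t) + 6 * w x t * \sum_i p i x t ^+ 2 + phi1
  - \sum_i (k2 (x 0 i) + 2 * p i x t * k1 (x 0 i)) <= 0.
Proof.
move=> t0 h0 e0 b0 b1 small Hphi Hk Hk1 Hx Hmin Hleft.
have T j : harnack_dx j h x t = 0 /\ 0 <= harnack_dxx j h x t.
  (* The second bound keeps the moving coordinate inside the interval where the barrier is
     differentiable. *)
  pose e' := Num.min eps (rad - `|x 0 j|).
  have e'0 : 0 < e' by rewrite lt_min e0 subr_gt0 Hx.
  have [|||d0 dd0] := @second_derivative_test _ (fun y => harnack h (x + y *: e j) t)
    (fun y => harnack_dx j h (x + y *: e j) t) (harnack_dxx j h x t) e' e'0.
  - move=> y; rewrite lt_min => /andP[_ y2]; apply: has_derive_harnack => //.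
    apply: Hk; rewrite !mxE !eqxx mulr1.
    by apply: le_lt_trans (ler_normD _ _) _; rewrite addrC -ltrBrDr.
  - by apply: has_derive_harnack_dx => //; exact: Hk1.
  - by move=> y; rewrite lt_min scale0r addr0 => /andP[y1 _]; exact: Hmin.
  by move: d0; rewrite scale0r addr0.
have D3 : harnack_dt phi1 h x t <= 0.
  exact: (derive_left_min e0 (has_derive_harnack_dt h x t0 Hphi) Hleft).
apply: (discrete_bochner (T0 := ut x t) (Tp := fun i => ut (x + h *: e i) t)
  (Tm := fun i => ut (x - h *: e i) t) (s := fun j => s j x t)
  (pp := fun i j => p j (x + h *: e i) t) (pm := fun i j => p j (x - h *: e i) t)
  (sp := fun i j => s j (x + h *: e i) t) (sm := fun i j => s j (x - h *: e i) t)) => //.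
- by move=> i; rewrite /quot divfK // gt_eqF.
- exact: log_eq.
- by move=> i; exact: log_eq.
- by move=> i; exact: log_eq.
- by move=> j; have [] := T j.
- by move=> j; have [] := T j.
Qed.

End MinimumPoint.

(** * Compact space-time boxes, bounds and minimisers *)

Section Compactness.
Context {R : realType} {n : nat}.
Local Set Implicit Arguments.
Local Unset Strict Implicit.
Local Unset Printing Implicit Defensive.

Definition box (rad d T : R) : set ('rV[R]_n * R) :=
  [set q : 'rV[R]_n * R | (forall i, `|q.1 0 i| <= rad) /\ d <= q.2 <= T].

Lemma compact_box (rad d T : R) : compact (box rad d T).
Proof.
have -> : box rad d T =
    [set v : 'rV[R]_n | forall i, `[- rad, rad]%classic (v ord0 i)] `*` `[d, T]%classic.
  apply/seteqP; split => -[v t] /=; rewrite /box /= !in_itv /=.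
    by move=> [H1 H2]; split => // i; rewrite in_itv /= -ler_norml.
  by move=> [H1 H2]; split => // i; have := H1 i; rewrite in_itv /= -ler_norml.
apply: compact_setX; last exact: segment_compact.
by apply: (@rV_compact R n (fun=> `[- rad, rad]%classic)) => i; exact: segment_compact.
Qed.

Lemma bounded_on_box (G : 'rV[R]_n -> R -> R) (rad d T : R) : 0 < d ->
  jointly_continuous G ->
  exists M, forall x t, (forall i, `|(x : 'rV[R]_n) 0 i| <= rad) -> d <= t <= T -> `|G x t| <= M.
Proof.
move=> d0 HG.
have C : {within box rad d T, continuous (fun q => G q.1 q.2)}.
  apply: continuous_in_subspaceT => -[x t]; rewrite inE => -[_ /= /andP[dt _]].
  by apply: HG; exact: lt_le_trans dt.
have [M [_ HM]] := compact_bounded (continuous_compact C (@compact_box rad d T)).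
exists (M + 1) => x t Hx Ht; apply: (HM (M + 1)); first by rewrite ltrDl.
by exists (x, t).
Qed.

Lemma minimizer_on_box (G : 'rV[R]_n -> R -> R) (rad d T : R) x0 t0 :
  box rad d T (x0, t0) ->
  (forall x t, box rad d T (x, t) -> {for (x, t), continuous (fun q => G q.1 q.2)}) ->
  exists q, box rad d T q /\ forall x t, box rad d T (x, t) -> G q.1 q.2 <= G x t.
Proof.
move=> H0 HG.
have [||q /set_mem qb Hq] := @compact_EVT_min _ R (fun q => G q.1 q.2) (box rad d T) _ (@compact_box rad d T).
- by exists (x0, t0).
- by apply: continuous_in_subspaceT => -[x t]; rewrite inE => /HG.
by exists q; split => // x t b; apply: (Hq (x, t)); rewrite inE.
Qed.

End Compactness.

(** * Passage to the limit of vanishing step at moving points *)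

Section HarnackLimit.
Context {R : realType} {n : nat}.
Local Set Implicit Arguments.
Local Unset Strict Implicit.
Local Unset Printing Implicit Defensive.
Local Notation e := (@basis_vec R n).
Implicit Types (x : 'rV[R]_n) (t h r : R).
Context (a b : R) (u ut : 'rV[R]_n -> R -> R) (p s : 'I_n -> 'rV[R]_n -> R -> R).
Hypothesis Hu : log_solution a b u ut p s.
Local Notation w := (reaction b u).

(** Reduces joint continuity to convergence along arbitrary filters, where limits of compound
    expressions can be assembled term by term. *)
Lemma jointly_continuous_fun (G : 'rV[R]_n -> R -> R) :
  (forall x t, 0 < t -> forall T (F : set_system T) (FF : Filter F)
     (X : T -> 'rV[R]_n) (Y : T -> R), X y @[y --> F] --> x -> Y y @[y --> F] --> t ->
     G (X y) (Y y) @[y --> F] --> G x t) -> jointly_continuous G.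
Proof.
move=> H x t t0; apply: (H x t t0 _ (nbhs (x, t)) _ fst snd); [exact: cvg_fst|exact: cvg_snd].
Qed.

Lemma line_derive_reaction i :
  line_derive i w (fun x t => 2 * w x t * p i x t).
Proof.
move=> x t t0; apply: has_derive_eq.
  by apply: has_deriveZ; apply: has_derive_expR; apply: has_deriveZ; exact: log_dx Hu _ x t t0.
by rewrite /= scale0r addr0 /reaction; ring.
Qed.

Lemma line_derive_reaction2 i :
  line_derive i (fun x t => 2 * w x t * p i x t)
    (fun x t => w x t * (2 * s i x t + 4 * p i x t ^+ 2)).
Proof.
move=> x t t0; apply: has_derive_eq.
  apply: has_deriveM; last exact: log_dxx Hu _ x t t0.
  by apply: has_deriveZ; exact: line_derive_reaction.
by rewrite /= scale0r addr0; ring.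
Qed.

Lemma reaction_cvg T (F : set_system T) (FF : Filter F) (X : T -> 'rV[R]_n) (Y : T -> R) x t :
  0 < t -> X y @[y --> F] --> x -> Y y @[y --> F] --> t ->
  w (X y) (Y y) @[y --> F] --> w x t.
Proof.
move=> t0 HX HY; rewrite /reaction; apply: cvgZ_fun.
apply: (@cvg_has_derive _ _ _ _ expR _ (2 * u x t) (expR (2 * u x t))).
  exact: is_derive_expR.
by apply: cvgZ_fun; apply: joint_cvg => //; exact: log_cont Hu.
Qed.

Lemma reaction_dx_cont i : jointly_continuous (fun x t => 2 * w x t * p i x t).
Proof.
apply: jointly_continuous_fun => x t t0 T F FF X Y HX HY.
apply: cvgM_fun; first by apply: cvgZ_fun; exact: reaction_cvg.
by apply: joint_cvg => //; exact: log_dx_cont Hu i.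
Qed.

Lemma reaction_dxx_cont i :
  jointly_continuous (fun x t => w x t * (2 * s i x t + 4 * p i x t ^+ 2)).
Proof.
apply: jointly_continuous_fun => x t t0 T F FF X Y HX HY.
apply: cvgM_fun; first exact: reaction_cvg.
apply: cvgD_fun; apply: cvgZ_fun; first by apply: joint_cvg => //; exact: log_dxx_cont Hu i.
by apply: cvg_sqr_fun; apply: joint_cvg => //; exact: log_dx_cont Hu i.
Qed.

Section AlongFilter.
Context (T : Type) (F : set_system T) (FF : ProperFilter F).
Context (X : T -> 'rV[R]_n) (Y h : T -> R) (x : 'rV[R]_n) (t : R).
Hypotheses (t0 : 0 < t) (HX : X y @[y --> F] --> x) (HY : Y y @[y --> F] --> t).
Hypotheses (Hh : h y @[y --> F] --> (0 : R)) (Hh0 : \forall y \near F, 0 < h y).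
Hypothesis HY0 : \forall y \near F, 0 < Y y.

Lemma fwd_quot_cvg i G dG : line_derive i G dG -> jointly_continuous dG ->
  (G (X y + h y *: e i) (Y y) - G (X y) (Y y)) / h y @[y --> F] --> dG x t.
Proof.
move=> L C; apply: (joint_cvg_near (i := i) _ t0 C HX HY Hh).
by apply: filterS2 Hh0 HY0 => y ? ?; exact: line_mvt.
Qed.

Lemma bwd_quot_cvg i G dG : line_derive i G dG -> jointly_continuous dG ->
  (G (X y - h y *: e i) (Y y) - G (X y) (Y y)) / h y @[y --> F] --> - dG x t.
Proof.
move=> L C.
rewrite (_ : (fun y => _) = fun y => - (- ((G (X y - h y *: e i) (Y y) - G (X y) (Y y)) / h y))).
  apply: cvgN; apply: (joint_cvg_near (i := i) _ t0 C HX HY Hh).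
  apply: filterS2 Hh0 HY0 => y h1 y1.
  by have [c c1 c2] := line_mvtN (X y) L y1 h1; exists c => //; rewrite c2 opprK.
by apply/funext => y; rewrite opprK.
Qed.

Lemma second_quot_cvg i G dG ddG : line_derive i G dG -> line_derive i dG ddG ->
  jointly_continuous ddG ->
  (G (X y + h y *: e i) (Y y) + G (X y - h y *: e i) (Y y) - 2 * G (X y) (Y y)) / h y ^+ 2
    @[y --> F] --> ddG x t.
Proof.
move=> L L2 C; apply: (joint_cvg_near (i := i) _ t0 C HX HY Hh).
by apply: filterS2 Hh0 HY0 => y ? ?; exact: line_mvt2 L L2 _ _.
Qed.

Lemma shift_cvg i G : jointly_continuous G ->
  G (X y + h y *: e i) (Y y) - G (X y) (Y y) @[y --> F] --> (0 : R).
Proof.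
move=> C; rewrite -[0](subrr (G x t)); apply: cvgB_fun; last exact: joint_cvg.
apply: (joint_cvg_near (i := i) _ t0 C HX HY Hh).
by apply: filterS Hh0 => y y0; exists (h y) => //; rewrite gtr0_norm.
Qed.

Lemma harnack_cvg beta phi k dphi (dk : 'I_n -> R) : has_derive phi t dphi ->
  (forall i, has_derive k (x 0 i) (dk i)) ->
  harnack b u beta phi k (h y) (X y) (Y y) @[y --> F] -->
    \sum_i s i x t + beta * \sum_i p i x t ^+ 2 - w x t + phi t + \sum_i k (x 0 i).
Proof.
move=> Hphi Hk; apply: cvgD_fun; first apply: cvgD_fun; first apply: cvgB_fun; first apply: cvgD_fun.
- by apply: cvg_sum_fun => i; exact: second_quot_cvg (log_dx Hu i) (log_dxx Hu i) (log_dxx_cont Hu (i := i)).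
- apply: cvgZ_fun; apply: cvg_sum_fun => i; apply: cvg_sqr_fun.
  exact: fwd_quot_cvg (log_dx Hu i) (log_dx_cont Hu (i := i)).
- exact: reaction_cvg.
- exact: cvg_has_derive Hphi _.
- by apply: cvg_sum_fun => i; apply: cvg_has_derive (Hk i) _; exact: coord_cvg.
Qed.

(** The limit of the left side of [harnack_min_ineq], with the barrier derivatives already replaced
    by a bound in [k] and [p]. Forward and backward quotients each contribute a multiple of
    [s i ^+ 2], whence the factor [2 * (1 - beta)]; the terms in [w] combine to [2 - 4 * beta]. *)
Lemma min_ineq_cvg beta (phi1 : R -> R) dphi1 k dk (c1 c2 : R) :
  has_derive phi1 t dphi1 -> (forall i, has_derive k (x 0 i) (dk i)) ->
  \sum_i ((1 - 2 * beta + 2 * beta * (quot u (h y) (X y) (Y y) i * h y))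
            * ((p i (X y + h y *: e i) (Y y) - p i (X y) (Y y)) / h y) ^+ 2
          + ((p i (X y - h y *: e i) (Y y) - p i (X y) (Y y)) / h y) ^+ 2)
  - \sum_i (w (X y + h y *: e i) (Y y) + w (X y - h y *: e i) (Y y) - 2 * w (X y) (Y y)) / h y ^+ 2
  - 2 * beta * \sum_i quot u (h y) (X y) (Y y) i * ((w (X y + h y *: e i) (Y y) - w (X y) (Y y)) / h y)
  - 2 * w (X y) (Y y) * (a - w (X y) (Y y)) + 6 * w (X y) (Y y) * \sum_i p i (X y) (Y y) ^+ 2 + phi1 (Y y)
  - \sum_i (c1 * k (X y 0 i) ^+ 2 + c2 * k (X y 0 i) * p i (X y) (Y y) ^+ 2)
  @[y --> F] -->
  2 * (1 - beta) * \sum_i s i x t ^+ 2 - 2 * w x t * \sum_i s i x t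
  + (2 - 4 * beta) * w x t * \sum_i p i x t ^+ 2 - 2 * a * w x t + 2 * w x t ^+ 2
  + phi1 t - \sum_i (c1 * k (x 0 i) ^+ 2 + c2 * k (x 0 i) * p i x t ^+ 2).
Proof.
move=> Hphi Hk.
have E : 2 * (1 - beta) * \sum_i s i x t ^+ 2 - 2 * w x t * \sum_i s i x t
  + (2 - 4 * beta) * w x t * \sum_i p i x t ^+ 2 - 2 * a * w x t + 2 * w x t ^+ 2
  + phi1 t - \sum_i (c1 * k (x 0 i) ^+ 2 + c2 * k (x 0 i) * p i x t ^+ 2) =
  \sum_i ((1 - 2 * beta + 2 * beta * (p i x t * 0)) * s i x t ^+ 2 + (- s i x t) ^+ 2)
  - \sum_i (w x t * (2 * s i x t + 4 * p i x t ^+ 2))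
  - 2 * beta * \sum_i p i x t * (2 * w x t * p i x t)
  - 2 * w x t * (a - w x t) + 6 * w x t * \sum_i p i x t ^+ 2 + phi1 t
  - \sum_i (c1 * k (x 0 i) ^+ 2 + c2 * k (x 0 i) * p i x t ^+ 2).
  congr (_ - _).
  have -> : \sum_i ((1 - 2 * beta + 2 * beta * (p i x t * 0)) * s i x t ^+ 2 + (- s i x t) ^+ 2)
     = 2 * (1 - beta) * \sum_i s i x t ^+ 2.
    by rewrite mulr_sumr; apply: eq_bigr => i _; ring.
  have -> : \sum_i (w x t * (2 * s i x t + 4 * p i x t ^+ 2)) =
     2 * w x t * \sum_i s i x t + 4 * w x t * \sum_i p i x t ^+ 2.
    by rewrite !mulr_sumr -big_split; apply: eq_bigr => i _ /=; ring.
  have -> : \sum_i p i x t * (2 * w x t * p i x t) = 2 * w x t * \sum_i p i x t ^+ 2.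
    by rewrite mulr_sumr; apply: eq_bigr => i _; ring.
  ring.
rewrite E.
have Hw : w (X y) (Y y) @[y --> F] --> w x t by exact: reaction_cvg.
have Hp i : p i (X y) (Y y) @[y --> F] --> p i x t.
  by apply: joint_cvg => //; exact: log_dx_cont Hu i.
have Hq i : quot u (h y) (X y) (Y y) i @[y --> F] --> p i x t.
  exact: fwd_quot_cvg (log_dx Hu i) (log_dx_cont Hu (i := i)).
have HK i : k (X y 0 i) @[y --> F] --> k (x 0 i).
  by apply: cvg_has_derive (Hk i) _; exact: coord_cvg.
apply: cvgB_fun; first apply: cvgD_fun; first apply: cvgD_fun; first apply: cvgB_fun; first apply: cvgB_fun;
  first apply: cvgB_fun.
- apply: cvg_sum_fun => i; apply: cvgD_fun.
    apply: cvgM_fun.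
      apply: cvgD_fun; first exact: cvg_cst.
      by apply: cvgZ_fun; exact: cvgM_fun.
    by apply: cvg_sqr_fun; exact: fwd_quot_cvg (log_dxx Hu i) (log_dxx_cont Hu (i := i)).
  by apply: cvg_sqr_fun; exact: bwd_quot_cvg (log_dxx Hu i) (log_dxx_cont Hu (i := i)).
- apply: cvg_sum_fun => i.
  exact: second_quot_cvg (@line_derive_reaction i) (@line_derive_reaction2 i) (@reaction_dxx_cont i).
- apply: cvgZ_fun; apply: cvg_sum_fun => i; apply: cvgM_fun => //.
  exact: fwd_quot_cvg (@line_derive_reaction i) (@reaction_dx_cont i).
- apply: cvgM_fun; first exact: cvgZ_fun.
  by apply: cvgB_fun => //; exact: cvg_cst.
- apply: cvgM_fun; first exact: cvgZ_fun.
  by apply: cvg_sum_fun => i; exact: cvg_sqr_fun.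
- exact: cvg_has_derive Hphi _.
- apply: cvg_sum_fun => i; apply: cvgD_fun; first by apply: cvgZ_fun; exact: cvg_sqr_fun.
  by apply: cvgM_fun; [exact: cvgZ_fun|exact: cvg_sqr_fun].
Qed.

End AlongFilter.

End HarnackLimit.

(** * The maximum principle on a cube *)

Section LocalEstimate.
Context {R : realType} {n : nat}.
Local Set Implicit Arguments.
Local Unset Strict Implicit.
Local Unset Printing Implicit Defensive.
Local Notation e := (@basis_vec R n).
Implicit Types (x : 'rV[R]_n) (t h r : R).
Context (a b : R) (u ut : 'rV[R]_n -> R -> R) (p s : 'I_n -> 'rV[R]_n -> R -> R).
Hypothesis Hu : log_solution a b u ut p s.
Hypotheses (n0 : (0 < n)%N) (a0 : 0 < a) (b0 : 0 < b).
Local Notation w := (reaction b u).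

Lemma reaction_ge0 x t : 0 <= w x t.
Proof. by rewrite mulr_ge0 ?expR_ge0 // ltW. Qed.

(** The constant does not depend on [h]: second differences are values of [s] in the larger cube,
    and the gradient term is nonnegative. Hence large [phi] or [k] excludes negative values of the
    quantity. *)
Lemma harnack_lower_bound beta phi k rad d T : 0 <= beta -> 0 < d ->
  exists M, forall h x t rad1, 0 < h -> h <= rad - rad1 ->
    (forall i, `|x 0 i| <= rad1) -> d <= t <= T ->
    phi t + \sum_i k (x 0 i) - M <= harnack b u beta phi k h x t.
Proof.
move=> be0 d0.
have [Mw HMw] := @bounded_on_box R n w rad d T d0
  (jointly_continuous_fun (fun x t ht _ F FF X Y HX HY => reaction_cvg Hu FF ht HX HY)).
have /choice[M HM] : forall i, exists M, forall x t,
    (forall j, `|x 0 j| <= rad) -> d <= t <= T -> `|s i x t| <= M.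
  by move=> i; exact: bounded_on_box d0 (log_dxx_cont Hu (i := i)).
exists (Mw + \sum_i M i) => h x t rad1 h0 hr Hx Ht.
have t0 : 0 < t by case/andP: Ht => dt _; exact: lt_le_trans dt.
have hx c i j : `|c| <= h -> `|(x + c *: e i) 0 j| <= rad.
  move=> ch; rewrite !mxE; apply: le_trans (ler_normD _ _) _.
  have := Hx j; have : `|c * ((0 == 0 :> 'I_1) && (j == i))%:R| <= h.
    rewrite normrM; apply: le_trans ch; rewrite ler_piMr //.
    by case: (_ && _); rewrite ?normr1 ?normr0.
  by lra.
have Hx' j : `|x 0 j| <= rad by apply: le_trans (Hx j) _; lra.
have W : w x t <= Mw by apply: le_trans (ler_norm _) _; exact: HMw.
have Q : 0 <= beta * \sum_i quot u h x t i ^+ 2.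
  by rewrite mulr_ge0 // sumr_ge0 // => i _; exact: sqr_ge0.
have S : - (\sum_i M i) <=
    \sum_i (u (x + h *: e i) t + u (x - h *: e i) t - 2 * u x t) / h ^+ 2.
  rewrite -sumrN; apply: ler_sum => i _.
  have [c ch ->] := line_mvt2 x (log_dx Hu i) (log_dxx Hu i) t0 h0.
  have := HM i (x + c *: e i) t (hx c i ^~ ch) Ht.
  by rewrite ler_norml => /andP[].
by rewrite /harnack; lra.
Qed.

Lemma harnack_continuous beta phi k dphi (dk : 'I_n -> R) h x t : 0 < t ->
  has_derive phi t dphi -> (forall i, has_derive k (x 0 i) (dk i)) ->
  {for (x, t), continuous (fun q => harnack b u beta phi k h q.1 q.2)}.
Proof.
move=> t0 Hphi Hk.
pose F := nbhs (x, t).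
have HX : q.1 @[q --> F] --> x by exact: cvg_fst.
have HY : q.2 @[q --> F] --> t by exact: cvg_snd.
have U v : u (q.1 + v) q.2 @[q --> F] --> u (x + v) t.
  apply: joint_cvg => //; first exact: log_cont Hu.
  by apply: cvgD => //; exact: cvg_cst.
have U0 : u q.1 q.2 @[q --> F] --> u x t.
  by apply: joint_cvg => //; exact: log_cont Hu.
apply: (@cvgD_fun _ _ F); first apply: (@cvgD_fun _ _ F); first apply: (@cvgB_fun _ _ F);
  first apply: (@cvgD_fun _ _ F).
- apply: cvg_sum_fun => i; apply: (@cvgM_fun _ _ F); last exact: cvg_cst.
  apply: (@cvgB_fun _ _ F); last exact: cvgZ_fun.
  by apply: (@cvgD_fun _ _ F); exact: U.
- apply: cvgZ_fun; apply: cvg_sum_fun => i; apply: cvg_sqr_fun.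
  apply: (@cvgM_fun _ _ F); last exact: cvg_cst.
  by apply: (@cvgB_fun _ _ F).
- exact: (reaction_cvg Hu (F := F) _ t0 HX HY).
- exact: (cvg_has_derive (F := F) Hphi HY).
- by apply: cvg_sum_fun => i; apply: cvg_has_derive (Hk i) _; exact: coord_cvg.
Qed.

(** If the value were negative, minimisers of the discretised quantity over a slightly smaller box
    would have negative values, hence avoid the initial slice and the sides. The minimum inequality
    then holds at them, and [h --> 0] contradicts [limit_contradiction]. The shift by [delta] places
    the blow-up of [rate] at a positive time, where the solution is regular. *)
Lemma local_harnack (tau rad delta : R) x0 t0 :
  let beta := tau / 8 in
  let c := tau / (2 * n%:R) in
  0 < tau -> tau <= 1 / 2 ->
  0 < delta -> delta < t0 -> (forall i, `|x0 0 i| < rad) ->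
  0 <= \sum_i s i x0 t0 + beta * \sum_i p i x0 t0 ^+ 2 - w x0 t0
    + n%:R * ((1 + tau) * rate a (t0 - delta))
    + \sum_i barrier ((28 + 16 / (2 * beta * c)) / c * rad ^+ 2) rad (x0 0 i).
Proof.
move=> beta c tau0 tau1 delta0 dt0 Hx0; rewrite leNgt; apply/negP => neg.
set A := (28 + 16 / (2 * beta * c)) / c * rad ^+ 2 in neg.
pose phi t := n%:R * ((1 + tau) * rate a (t - delta)).
pose phi1 t := n%:R * ((1 + tau) * ((a ^+ 2 + 2 * a * rate a (t - delta) - 3 * rate a (t - delta) ^+ 2) / 2)).
pose k := barrier A rad.
have N0 : 0 < n%:R :> R by rewrite ltr0n.
have N1 : 1 <= n%:R :> R by rewrite ler1n.
have beta0 : 0 < beta by rewrite divr_gt0.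
have beta1 : beta <= 1 / 16 by rewrite /beta; lra.
have c0 : 0 < c by rewrite divr_gt0 // mulr_gt0.
have c20 : 0 < 2 * beta * c by apply: mulr_gt0 => //; exact: mulr_gt0.
have rad0 : 0 < rad by apply: le_lt_trans (Hx0 (Ordinal n0)).
have A0 : 0 < A.
  by apply: mulr_gt0; [apply: divr_gt0 => //; apply: addr_gt0 => //; exact: divr_gt0|exact: exprn_gt0].
have Hr t : delta < t -> has_derive (fun y => rate a (y - delta)) t
    ((a ^+ 2 + 2 * a * rate a (t - delta) - 3 * rate a (t - delta) ^+ 2) / 2).
  move=> dt; apply: has_derive_shift; apply: has_derive_rate => //; by rewrite subr_gt0.
have Hphi t : delta < t -> has_derive phi t (phi1 t).
  by move=> dt; do 2! apply: has_deriveZ; exact: Hr.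
have Hk r : `|r| < rad -> has_derive k r (barrier1 A rad r) by exact: has_derive_barrier.
have Hk1 r : `|r| < rad -> has_derive (barrier1 A rad) r (barrier2 A rad r).
  exact: has_derive_barrier1.
have k0 r : 0 <= k r by apply: barrier_ge0; exact: ltW.
have [M HM] := @harnack_lower_bound beta phi k rad delta t0 (ltW beta0) delta0.
(* Since [M] is already fixed, the box can be chosen so that [rate] exceeds [M] on its initial slice
   and the barrier exceeds [M] on its sides. *)
have [d1 [d1_0 d1_t M1]] : exists t, [/\ 0 < t, t < t0 - delta & M < rate a t].
  by apply: rate_unbounded => //; rewrite subr_gt0.
pose X0 := \big[Order.max/0]_(i < n) `|x0 0 i|.
have X00 : 0 <= X0 < rad.
  by rewrite bigmax_lt // andbT; exact: bigmax_ge_id.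
have [rad1 [r1_X r1_r M2]] := barrier_unbounded M A0 X00.
have Hx0' i : `|x0 0 i| < rad1 by apply: le_lt_trans r1_X; exact: le_bigmax.
pose t1 := delta + d1.
have t1_0 : 0 < t1 by rewrite addr_gt0.
have K0 : box rad1 t1 t0 (x0, t0).
  split=> [i|] /=; first exact: ltW.
  by rewrite lexx andbT /t1; lra.
have in_rad x t i : box rad1 t1 t0 (x, t) -> `|x 0 i| < rad.
  by move=> [/(_ i) /= H _]; exact: le_lt_trans r1_r.
have in_t x t : box rad1 t1 t0 (x, t) -> delta < t.
  by move=> [_ /= /andP[H _]]; apply: lt_le_trans H; rewrite ltrDl.
pose H h q := harnack b u beta phi k h q.1 q.2.
have [q Hq] : {q : R -> 'rV[R]_n * R & forall h, box rad1 t1 t0 (q h) /\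
    forall x t, box rad1 t1 t0 (x, t) -> H h (q h) <= H h (x, t)}.
  apply: (@choice _ _ (fun h q => box rad1 t1 t0 q /\
    forall x t, box rad1 t1 t0 (x, t) -> H h q <= H h (x, t))) => h.
  have [|q [qb qm]] := @minimizer_on_box R n (harnack b u beta phi k h) rad1 t1 t0 x0 t0 K0.
    move=> x t xt; have dt := in_t _ _ xt.
    apply: (@harnack_continuous _ _ _ (phi1 t) (fun i => barrier1 A rad (x 0 i))).
    - exact: lt_trans dt.
    - exact: Hphi.
    - by move=> i; apply: Hk; exact: in_rad xt.
  by exists q.
(* Indexing by the pairs [(h, q h)], one ultrafilter yields both [h --> 0] and
   the convergence of the minimisers. *)
pose F0 : set_system (R * ('rV[R]_n * R)) := (fun h => (h, q h)) @ 0^'+.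
have [G [UG GF]] := @ultraFilterLemma _ F0 _.
have nearG (P : R * ('rV[R]_n * R) -> Prop) :
  (\forall h \near (0:R)^'+, P (h, q h)) -> \forall y \near G, P y by exact: GF.
have hG : y.1 @[y --> G] --> (0 : R).
  have h0 : id y @[y --> (0:R)^'+] --> (0 : R) by apply: cvg_at_right_filter; exact: cvg_id.
  by move=> B /h0 Bn; apply: nearG.
have h0G : \forall y \near G, 0 < y.1 by apply: nearG; exact: nbhs_right_gt.
have hrG : \forall y \near G, y.1 <= rad - rad1.
  by apply: nearG; apply: nbhs_right_le; rewrite subr_gt0.
have GK : G (`[0, 1]%classic `*` box rad1 t1 t0).
  have lt01 : 0 < 1 :> R by [].
  apply: nearG; apply: filterS2 (nbhs_right_gt 0) (nbhs_right_le lt01) => h h1 h2.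
  by split; [rewrite /= in_itv /= (ltW h1) h2 | have [] := Hq h].
have := compact_setX (@segment_compact R 0 1) (@compact_box R n rad1 t1 t0).
(* The limit point stays in the closed box, which lies strictly inside the region where barrier and
   shifted rate are differentiable. *)
rewrite compact_ultra => /(_ G UG GK) [[hs [xs ts]] [[_ /= qsK] /= qs]].
have qs2 : y.2 @[y --> G] --> (xs, ts) by exact: (cvg_comp _ _ qs (@cvg_snd _ _ _ _ _)).
have HX : y.2.1 @[y --> G] --> xs by exact: (cvg_comp _ _ qs2 (@cvg_fst _ _ _ _ _)).
have HY : y.2.2 @[y --> G] --> ts by exact: (cvg_comp _ _ qs2 (@cvg_snd _ _ _ _ _)).
have dts := in_t _ _ qsK.
have ts0 : 0 < ts by exact: lt_trans dts.
have HY0 : \forall y \near G, 0 < y.2.2.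
  apply: nearG; apply: nearW => y; have [] := Hq y.
  by case: (q y) => x t /in_t dt _; exact: lt_trans dt.
have xs_rad i : `|xs 0 i| < rad by exact: in_rad qsK.
(* At the fixed point [(x0, t0)] the discretised quantity tends to the negative value assumed, and
   the minimum lies below it. *)
have neg_near0 : \forall h \near 0^'+, H h (q h) < 0.
  have L : H h (x0, t0) @[h --> 0^'+] --> \sum_i s i x0 t0 + beta * \sum_i p i x0 t0 ^+ 2 - w x0 t0
      + phi t0 + \sum_i k (x0 0 i).
    apply: (harnack_cvg Hu _ (X := fun=> x0) (Y := fun=> t0) _ _ _ _ _ _ (dphi := phi1 t0)
      (dk := fun i => barrier1 A rad (x0 0 i))).
    - exact: lt_trans dt0.
    - exact: cvg_cst.
    - exact: cvg_cst.
    - by apply: cvg_at_right_filter; exact: cvg_id.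
    - exact: nbhs_right_gt.
    - by apply: nearW => y; exact: lt_trans dt0.
    - exact: Hphi.
    - by move=> i; exact: Hk.
  have N : \forall h \near 0^'+, H h (x0, t0) < 0. refine (@cvgr_lt _ _ _ _ _ _ L _ neg).
  near=> h; apply: (@le_lt_trans _ _ (H h (x0, t0))).
    by have [_] := Hq h; apply.
  by near: h.
have neg_near : \forall y \near G, H y.1 y.2 < 0 by exact: nearG.
have min_near : \forall y \near G, box rad1 t1 t0 y.2 /\
    forall x t, box rad1 t1 t0 (x, t) -> H y.1 y.2 <= H y.1 (x, t).
  by apply: nearG; apply: nearW => h; exact: Hq.
(* The barrier derivatives are replaced by their bound before the limit: [k1] becomes 0 and [k2] the
   right side of [barrier_ineq]. *)
apply: (@limit_contradiction R n a tau (rate a (ts - delta)) (w xs ts) (phi ts)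
  (fun i => s i xs ts) (fun i => p i xs ts) (fun i => k (xs 0 i)) (fun=> 0)
  (fun i => c * k (xs 0 i) ^+ 2 + 2 * beta * c * k (xs 0 i) * p i xs ts ^+ 2)) => //.
- by apply: rate_ge => //; rewrite subr_gt0.
- exact: reaction_ge0.
- by move=> i; rewrite mulr0 addr0.
- have L : H y.1 y.2 @[y --> G] --> \sum_i s i xs ts + beta * \sum_i p i xs ts ^+ 2 - w xs ts
      + phi ts + \sum_i k (xs 0 i).
    exact: (harnack_cvg Hu _ ts0 HX HY hG h0G HY0 (Hphi _ dts) (fun i => Hk _ (xs_rad i))).
  by refine (cvgr_to_le L _); near=> y; apply: ltW; near: y; exact: neg_near.
have [d2 Dphi1] : exists d, has_derive phi1 ts d.
  eexists; apply: has_deriveZ; apply: has_deriveZ; apply: has_deriveM; last exact: has_derive_cst.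
  apply: has_deriveB; last by apply: has_deriveZ; apply: has_derive_sqr; exact: Hr.
  by apply: has_deriveD; [exact: has_derive_cst|apply: has_deriveZ; exact: Hr].
have L := min_ineq_cvg Hu _ ts0 HX HY hG h0G HY0 (beta := beta) (c1 := c)
  (c2 := 2 * beta * c) Dphi1 (fun i => Hk _ (xs_rad i)).
have -> : \sum_i (c * k (xs 0 i) ^+ 2 + 2 * beta * c * k (xs 0 i) * p i xs ts ^+ 2 + 2 * p i xs ts * 0)
  = \sum_i (c * k (xs 0 i) ^+ 2 + 2 * beta * c * k (xs 0 i) * p i xs ts ^+ 2).
  by apply: eq_bigr => i _; rewrite mulr0 addr0.
refine (cvgr_to_le (L _) _).
have small : \forall y \near G, forall i, `|u (y.2.1 + y.1 *: e i) y.2.2 - u y.2.1 y.2.2| <= 1 / 2.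
  apply: filter_forall => i.
  have S : u (y.2.1 + y.1 *: e i) y.2.2 - u y.2.1 y.2.2 @[y --> G] --> (0 : R).
    exact: (shift_cvg _ ts0 HX HY hG h0G i (log_cont Hu)).
  have half0 : 0 < 1 / 2 :> R by rewrite divr_gt0.
  have S' := proj1 (@cvgr0Pnorm_lt _ _ _ _ _ _) S _ half0.
  by near=> y; apply: ltW; near: y; exact: S'.
near=> y.
have h0 : 0 < y.1 by near: y.
have hr : y.1 <= rad - rad1 by near: y.
have sm : forall i, `|u (y.2.1 + y.1 *: e i) y.2.2 - u y.2.1 y.2.2| <= 1 / 2 by near: y.
have Hneg : H y.1 y.2 < 0 by near: y.
have [yK ymin] : box rad1 t1 t0 y.2 /\
    forall x t, box rad1 t1 t0 (x, t) -> H y.1 y.2 <= H y.1 (x, t) by near: y.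
move: sm Hneg yK ymin h0 hr; case: (y) => h [x t]; rewrite /H /= => sm Hneg yK ymin h0 hr.
have [/= Kx /andP[t1t tt0]] := yK.
have dt := in_t _ _ yK; have tpos : 0 < t by exact: lt_trans dt.
have Hlow := HM h x t rad1 h0 hr Kx.
(* Negativity at the minimiser bounds the rate and the barrier there by [M]; this rules out [t = t1]
   and [|x 0 i| = rad1] below. *)
have {Hlow}Hlow : phi t + \sum_i k (x 0 i) < M.
  have : delta <= t <= t0 by rewrite tt0 ltW.
  by move/Hlow => H1; have := le_lt_trans H1 Hneg; rewrite subr_lt0.
have phi_ge r : delta < r -> rate a (r - delta) <= phi r.
  move=> dr; have := @rate_ge R a (r - delta) a0; rewrite subr_gt0 => /(_ dr) ra.
  have ra0 : 0 <= rate a (r - delta) := le_trans (ltW a0) ra.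
  have ra1 : rate a (r - delta) <= (1 + tau) * rate a (r - delta).
    by rewrite ler_peMl // lerDl ltW.
  by apply: le_trans ra1 _; rewrite /phi ler_peMl // mulr_ge0 // addr_ge0 // ltW.
have t1_lt : t1 < t.
  rewrite lt_neqAle t1t andbT; apply/eqP => tE.
  have := phi_ge _ dt; rewrite -{1}tE /t1 (addrC delta) addrK => p1.
  have : 0 <= \sum_i k (x 0 i) by apply: sumr_ge0.
  by lra.
have x_lt i : `|x 0 i| < rad1.
  rewrite lt_neqAle Kx andbT; apply/eqP => xE.
  have kE : k (x 0 i) = barrier A rad rad1.
    by rewrite /k /barrier -xE real_normK // num_real.
  have kS : k (x 0 i) <= \sum_i k (x 0 i) by rewrite (bigD1 i) //= lerDl sumr_ge0.
  have phi0 : 0 <= phi t.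
    apply: le_trans (phi_ge _ dt); apply: le_trans (ltW a0) (rate_ge a0 _).
    by rewrite subr_gt0.
  have := lt_trans Hlow M2; rewrite -kE ltNge => /negP; apply.
  by apply: le_trans kS _; rewrite lerDr.
pose m := \big[Order.max/0]_(i < n) `|x 0 i|.
have m_lt : m < rad1.
  by apply: bigmax_lt => //; apply: le_lt_trans r1_X; case/andP: X00.
have m_ge i : `|x 0 i| <= m by exact: le_bigmax.
(* Small moves in space and backwards in time remain in the box. Forward moves are not considered,
   as [t] may equal [t0]. *)
pose eps := Num.min (t - t1) (rad1 - m).
have eps0 : 0 < eps by rewrite lt_min !subr_gt0 t1_lt m_lt.
have eps1 : eps <= t - t1 by rewrite ge_min lexx.
have eps2 : eps <= rad1 - m by rewrite ge_min lexx orbT.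
have xr i : `|x 0 i| < rad by exact: in_rad yK.
have := @harnack_min_ineq R n a b u ut p s Hu beta phi k (barrier1 A rad) (barrier2 A rad)
  h x t eps rad (phi1 t) tpos h0 eps0 beta0 beta1 sm (Hphi _ dt) Hk Hk1 xr.
have Hj j r : `|r| < eps -> harnack b u beta phi k h x t <= harnack b u beta phi k h (x + r *: e j) t.
  move=> re; apply: ymin; split=> /= [i|]; last by rewrite t1t.
  rewrite !mxE; apply: le_trans (ler_normD _ _) _.
  have : `|r * ((0 == 0 :> 'I_1) && (i == j))%:R| <= eps.
    rewrite normrM; apply: le_trans (ltW re); rewrite ler_piMr //.
    by case: (_ && _); rewrite ?normr1 ?normr0.
  by have := m_ge i; lra.
have Ht r : t - eps < r <= t -> harnack b u beta phi k h x t <= harnack b u beta phi k h x r.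
  by move=> /andP[r1 r2]; apply: ymin; split=> //=; apply/andP; split; lra.
move=> /(_ Hj Ht); apply: le_trans.
rewrite lerD2l lerN2; apply: ler_sum => i _.
by apply: barrier_ineq.
Unshelve. all: by end_near. Qed.

End LocalEstimate.

(** * Sharp estimate and integration along segments *)

Section ChainRule.
Context {R : realType}.
Local Set Implicit Arguments.
Local Unset Strict Implicit.
Local Unset Printing Implicit Defensive.

Lemma has_deriveP (F : R -> R) x d :
  has_derive F x d <-> h^-1 * (F (h + x) - F x) @[h --> 0^'] --> d.
Proof.
have E : (fun h : R => h^-1 *: ((F \o shift x) (h *: (1 : R)) - F x)) =
         (fun h => h^-1 * (F (h + x) - F x)).
  by apply/funext => h /=; rewrite [_ *: (1 : R)]mulr1.
split=> [[D V]|C].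
  by move: D; rewrite /derivable -V /derive E => /cvgP.
by split; [rewrite /derivable E; apply/cvg_ex; exists d|rewrite /derive E; exact: cvg_lim C].
Qed.

(** The increment splits into [G h h - G 0 h], handled by the mean value theorem and continuity of
    [dG], and [G 0 h - G 0 0]. Total differentiability of [G] is thus avoided. *)
Lemma has_derive_diag (G dG : R -> R -> R) (d eps : R) : 0 < eps ->
  (forall y z, `|z| < eps -> has_derive (G ^~ z) y (dG y z)) ->
  {for ((0 : R), (0 : R)), continuous (fun q : R * R => dG q.1 q.2)} ->
  has_derive (G 0) 0 d -> has_derive (fun r => G r r) 0 (dG 0 0 + d).
Proof.
move=> e0 HG C /has_deriveP H0; apply/has_deriveP.
have M h : h != 0 -> `|h| < eps -> exists2 c, `|c| <= `|h| & h^-1 * (G h h - G 0 h) = dG c h.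
  move=> hn he; have [h0|h0|h0] := ltgtP h 0.
  - have [r _|c /andP[c1 c2] E] := @mvt _ (G ^~ h) (dG ^~ h) h 0 h0; first exact: HG.
    exists c; first by rewrite !ltr0_norm // lerN2 ltW.
    by rewrite -opprB E sub0r; field.
  - have [r _|c /andP[c1 c2] E] := @mvt _ (G ^~ h) (dG ^~ h) 0 h h0; first exact: HG.
    exists c; first by rewrite !gtr0_norm // ltW.
    by rewrite E subr0; field.
  - by rewrite h0 eqxx in hn.
have L : h^-1 * (G h h - G 0 h) @[h --> 0^'] --> dG 0 0.
  apply/cvgrPdist_lt => e he.
  move/cvgrPdist_lt : (C) => /(_ e he) /nbhs_ballP[r /= r0 Hr].
  near=> h.
  have hn : h != 0 by near: h; exact: nbhs_dnbhs_neq.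
  have h_eps : `|h| < Num.min eps r.
    near: h; apply: dnbhs0_lt; by rewrite lt_min e0.
  move: h_eps; rewrite lt_min => /andP[h1 h2].
  have [c c1 ->] := M h hn h1.
  apply: (Hr (c, h)); split => /=; rewrite /ball /= sub0r normrN //.
  exact: le_lt_trans h2.
have E : (fun h => h^-1 * (G (h + 0) (h + 0) - G 0 0)) =
   (fun h => h^-1 * (G h h - G 0 h) + h^-1 * (G 0 (h + 0) - G 0 0)).
  by apply/funext => h; rewrite addr0; ring.
by rewrite E; exact: cvgD.
Unshelve. all: by end_near. Qed.

End ChainRule.

(** * Exhausting the space, removing the parameters, integrating *)

Section SharpEstimate.
Context {R : realType} {n : nat}.
Local Set Implicit Arguments.
Local Unset Strict Implicit.
Local Unset Printing Implicit Defensive.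
Local Notation e := (@basis_vec R n).
Context (a b : R) (u ut : 'rV[R]_n -> R -> R) (p s : 'I_n -> 'rV[R]_n -> R -> R).
Hypothesis Hu : log_solution a b u ut p s.
Hypotheses (n0 : (0 < n)%N) (a0 : 0 < a) (b0 : 0 < b).
Local Notation w := (reaction b u).

(** The barrier constant grows like [rad ^+ 2] but the squared gap like [rad ^+ 4], so at a fixed
    point the barrier vanishes as the cube grows. *)
Lemma global_harnack (tau delta : R) (x : 'rV[R]_n) (t : R) : 0 < tau -> tau <= 1 / 2 ->
  0 < delta -> delta < t ->
  0 <= \sum_i s i x t + tau / 8 * \sum_i p i x t ^+ 2 - w x t
    + n%:R * ((1 + tau) * rate a (t - delta)).
Proof.
move=> tau0 tau1 d0 dt; rewrite leNgt; apply/negP; set V := (X in X < 0) => V0.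
have N0 : 0 < n%:R :> R by rewrite ltr0n.
pose c := tau / (2 * n%:R).
have c0 : 0 < c by rewrite divr_gt0 // mulr_gt0.
pose K := (28 + 16 / (2 * (tau / 8) * c)) / c.
have K0 : 0 < K.
  apply: divr_gt0 => //; apply: addr_gt0 => //; apply: divr_gt0 => //.
  by apply: mulr_gt0 => //; apply: mulr_gt0 => //; exact: divr_gt0.
pose m := \big[Order.max/0]_(i < n) `|x 0 i|.
have m0 : 0 <= m by exact: bigmax_ge_id.
have m_ge i : `|x 0 i| <= m by exact: le_bigmax.
pose B := 2 * n%:R * K / - V.
have B0 : 0 < B.
  by apply: divr_gt0; rewrite ?oppr_gt0 //; apply: mulr_gt0 => //; exact: mulr_gt0.
(* The bound [2 * m] makes each gap at least [3 / 4 * rad ^+ 2], the bound 1 lowers the fourth power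
   to [rad ^+ 3 / 2], and [B] makes the total barrier smaller than [- V]. *)
have [rad [rad1 m_rad B_rad]] : exists rad : R, [/\ 1 <= rad, 2 * m <= rad & B < rad].
  by exists (2 * m + 1 + B); split; lra.
have Bk i : barrier (K * rad ^+ 2) rad (x 0 i) <= 2 * K / rad.
  have x2 : x 0 i ^+ 2 <= rad ^+ 2 / 4.
    rewrite -(real_normK (num_real _)); apply: (@le_trans _ _ (m ^+ 2)).
      by rewrite ler_pXn2r ?nnegrE.
    by nra.
  have r2 : 0 < rad ^+ 2 by rewrite exprn_gt0 //; lra.
  have g0 : 0 < rad ^+ 2 - x 0 i ^+ 2 by lra.
  rewrite /barrier ler_pdivrMr ?exprn_gt0 //.
  have g2 : (3 / 4 * rad ^+ 2) ^+ 2 <= (rad ^+ 2 - x 0 i ^+ 2) ^+ 2.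
    by rewrite ler_pXn2r ?nnegrE //; lra.
  have g3 : rad ^+ 3 / 2 <= (rad ^+ 2 - x 0 i ^+ 2) ^+ 2.
    apply: le_trans g2; rewrite -subr_ge0.
    have -> : (3 / 4 * rad ^+ 2) ^+ 2 - rad ^+ 3 / 2 = rad ^+ 3 * (9 / 16 * rad - 1 / 2) by field.
    by rewrite mulr_ge0 ?exprn_ge0 //; lra.
  have -> : K * rad ^+ 2 = 2 * K / rad * (rad ^+ 3 / 2) by field; rewrite gt_eqF //; lra.
  have Kr : 0 < 2 * K / rad by apply: divr_gt0; [exact: mulr_gt0|lra].
  by rewrite (ler_pM2l Kr).
have := @local_harnack R n a b u ut p s Hu n0 a0 b0 tau rad delta x t tau0 tau1 d0 dt.
have Hx i : `|x 0 i| < rad by apply: le_lt_trans (m_ge i) _; lra.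
move=> /(_ Hx); rewrite -/c -/K -/V; apply/negP; rewrite -ltNge.
have : \sum_i barrier (K * rad ^+ 2) rad (x 0 i) <= n%:R * (2 * K / rad).
  apply: (@le_trans _ _ (\sum_(i < n) (2 * K / rad))); first exact: ler_sum.
  by rewrite sumr_const card_ord -[leLHS]mulr_natl.
have : n%:R * (2 * K / rad) < - V.
  rewrite mulrA ltr_pdivrMr; last by lra.
  have -> : n%:R * (2 * K) = - V * B by rewrite /B; field; rewrite lt_eqF.
  by rewrite ltr_pM2l ?oppr_gt0.
by lra.
Qed.

Lemma sharp_harnack (x : 'rV[R]_n) (t : R) : 0 < t ->
  0 <= \sum_i s i x t - w x t + n%:R * rate a t.
Proof.
move=> t0.
(* A single parameter tending to 0 plays the roles of both [tau] and [delta]. *)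
have L : \sum_i s i x t + tau / 8 * \sum_i p i x t ^+ 2 - w x t
    + n%:R * ((1 + tau) * rate a (t - tau)) @[tau --> (0 : R)^'+] -->
   \sum_i s i x t + 0 / 8 * \sum_i p i x t ^+ 2 - w x t
    + n%:R * ((1 + 0) * rate a t).
  have I : tau @[tau --> (0:R)^'+] --> (0 : R) by apply: cvg_at_right_filter; exact: cvg_id.
  apply: cvgD_fun; first apply: cvgB_fun; first apply: cvgD_fun.
  - exact: cvg_cst.
  - apply: cvgM_fun; last exact: cvg_cst.
    by apply: cvgM_fun => //; exact: cvg_cst.
  - exact: cvg_cst.
  - apply: cvgZ_fun; apply: cvgM_fun.
      by apply: cvgD_fun => //; exact: cvg_cst.
    apply: cvg_has_derive (has_derive_rate a0 t0) _.
    by rewrite -[X in _ --> X]subr0; apply: cvgB_fun => //; exact: cvg_cst.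
rewrite (_ : \sum_i s i x t - w x t + n%:R * rate a t =
  \sum_i s i x t + 0 / 8 * \sum_i p i x t ^+ 2 - w x t + n%:R * ((1 + 0) * rate a t)); last first.
  by rewrite !mul0r !addr0 mul1r.
refine (cvgr_to_ge L _); near=> tau.
have tau0 : 0 < tau by near: tau; exact: nbhs_right_gt.
have tau1 : tau <= 1 / 2 by near: tau; apply: nbhs_right_le; rewrite divr_gt0.
have tau2 : tau < t by near: tau; exact: nbhs_right_lt.
exact: global_harnack.
Unshelve. all: by end_near. Qed.

(** The chain rule along a space-time line, by induction on the coordinates that move; each new
    coordinate is added through [has_derive_diag], using continuity of its partial derivative. *)
Lemma has_derive_line (x q : 'rV[R]_n) (t : R) (l : seq 'I_n) : 0 < t ->
  has_derive (fun r => u (x + r *: \sum_(i <- l) q 0 i *: e i) (t + r)) 0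
    (ut x t + \sum_(i <- l) q 0 i * p i x t).
Proof.
move=> t0; elim: l => [|i l IH].
  rewrite !big_nil addr0.
  have H : has_derive (u x) (0 + t) (ut x t) by rewrite add0r; exact: log_dt Hu _ _ t0.
  apply: (has_derive_ext (has_derive_shift H)) => // r.
  by rewrite scaler0 addr0 addrC.
rewrite !big_cons [ut x t + _]addrCA.
set v := \sum_(i <- l) q 0 i *: e i in IH *.
(* The new coordinate moves with [y]; time and the earlier coordinates move with [z]. *)
pose G y z := u (x + y *: (q 0 i *: e i) + z *: v) (t + z).
pose dG y z := q 0 i * p i (x + y *: (q 0 i *: e i) + z *: v) (t + z).
have dG0 : dG 0 0 = q 0 i * p i x t by rewrite /dG !scale0r !addr0.
rewrite -dG0.
apply: (@has_derive_ext _ _ (fun r => G r r)) => //; last first.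
  by move=> r; rewrite /G scalerDr addrA.
apply: (@has_derive_diag _ G dG _ t) => //.
- move=> y z zt.
  have tz : 0 < t + z by move: zt; rewrite ltr_norml => /andP[? ?]; lra.
  have H := line_deriveP (log_dx Hu i) x (z *: v) (y * q 0 i) tz.
  have Hq : has_derive (fun y => y * q 0 i) y (q 0 i).
    apply: (has_derive_eq (has_deriveM (has_derive_id y) (has_derive_cst (q 0 i) y))).
    by rewrite mul1r mulr0 addr0.
  apply: (has_derive_ext (has_derive_comp (G := fun y => y * q 0 i) H Hq)) => [r|].
    by rewrite /G scalerA.
  by rewrite /dG scalerA mulrC.
- rewrite /prop_for /continuous_at /=.
  apply: cvgZ_fun; apply: joint_cvg.
  + by rewrite addr0.
  + exact: log_dx_cont Hu i.
  + apply: cvgD; first apply: cvgD; first exact: cvg_cst.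
      by apply: cvgZr_tmp; exact: cvg_fst.
    by apply: cvgZr_tmp; exact: cvg_snd.
  + by apply: cvgD; [exact: cvg_cst|exact: cvg_snd].
apply: (has_derive_ext IH) => // r.
by rewrite /G scale0r addr0.
Qed.

Lemma row_basis (q : 'rV[R]_n) : \sum_i q 0 i *: e i = q.
Proof. by rewrite [RHS]row_sum_delta. Qed.

Lemma log_harnack (x1 x2 : 'rV[R]_n) (t1 t2 : R) : 0 < t1 -> t1 < t2 ->
  a * (1 + n%:R / 3) * (t2 - t1)
  - 2 * n%:R / 3 * (ln (expR (2 * a * t2) - 1) - ln (expR (2 * a * t1) - 1))
  - (\sum_i (x2 - x1) 0 i ^+ 2) / (4 * (t2 - t1)) <= u x2 t2 - u x1 t1.
Proof.
move=> t10 t12.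
have T0 : 0 < t2 - t1 by rewrite subr_gt0.
pose q := (t2 - t1)^-1 *: (x2 - x1).
pose g r := x1 + (r - t1) *: q.
pose Q := \sum_i q 0 i ^+ 2.
(* The subtracted function is a primitive of [a - n psi - Q / 4], the lower bound for the derivative
   of [u] along the segment; so [F] is nondecreasing. *)
pose F r := u (g r) r - (a * (1 + n%:R / 3) * r - 2 * n%:R / 3 * ln (expR (2 * a * r) - 1) - Q / 4 * r).
pose dF r := ut (g r) r + \sum_i q 0 i * p i (g r) r - (a - n%:R * rate a r - Q / 4).
have HF r : t1 <= r <= t2 -> has_derive F r (dF r).
  move=> /andP[r1 r2]; have r0 : 0 < r by exact: lt_le_trans r1.
  have E1 := expR2_gt1 a0 r0.
  apply: has_deriveB.
    have := has_derive_line (g r) q (index_enum 'I_n) r0.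
    rewrite row_basis -[X in has_derive _ X _](subrr r) => H.
    apply: (has_derive_ext (has_derive_shift H)) => // y /=.
    rewrite [r + _]addrC subrK; congr (u _ y).
    by rewrite /g -addrA -scalerDl; congr (_ + _ *: _); ring.
  have He : has_derive (fun y => expR (2 * a * y) - 1) r (expR (2 * a * r) * (2 * a) - 0).
    apply: has_deriveB; last exact: has_derive_cst.
    by apply: has_derive_expR; apply: (has_derive_eq (has_deriveZ _ (has_derive_id r))); rewrite mulr1.
  have E0 : 0 < expR (2 * a * r) - 1 by rewrite subr_gt0.
  have Hl := has_derive_ln He E0.
  apply: (has_derive_eq (has_deriveB (has_deriveB (has_deriveZ (a * (1 + n%:R / 3)) (has_derive_id r))
    (has_deriveZ (2 * n%:R / 3) Hl)) (has_deriveZ (Q / 4) (has_derive_id r)))).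
  by rewrite /rate; field; rewrite gt_eqF.
have dF0 r : t1 <= r <= t2 -> 0 <= dF r.
  move=> /andP[r1 r2]; have r0 : 0 < r by exact: lt_le_trans r1.
  have := sharp_harnack (g r) r0; rewrite /reaction => HS.
  rewrite /dF (log_eq Hu _ r0) big_split /=.
  (* This square absorbs the transport term [q . grad u] into [|grad u|^2] at the cost of
     [Q / 4]. *)
  have : 0 <= \sum_i (p i (g r) r + q 0 i / 2) ^+ 2 by apply: sumr_ge0 => i _; exact: sqr_ge0.
  have -> : \sum_i (p i (g r) r + q 0 i / 2) ^+ 2 = \sum_i p i (g r) r ^+ 2
     + \sum_i q 0 i * p i (g r) r + Q / 4.
    by rewrite /Q mulr_suml -!big_split; apply: eq_bigr => i _ /=; field.
  by lra.
have := nondecreasing_derive (ltW t12) HF dF0.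
have g1 : g t1 = x1 by rewrite /g subrr scale0r addr0.
have g2 : g t2 = x2.
  by rewrite /g /q scalerA mulfV ?gt_eqF // scale1r addrC subrK.
have QE : (\sum_i (x2 - x1) 0 i ^+ 2) / (4 * (t2 - t1)) = Q / 4 * (t2 - t1).
  rewrite /Q.
  have -> : \sum_i q 0 i ^+ 2 = (\sum_i (x2 - x1) 0 i ^+ 2) / (t2 - t1) ^+ 2.
    by rewrite mulr_suml; apply: eq_bigr => i _; rewrite /q mxE; field; rewrite gt_eqF.
  by field; rewrite gt_eqF.
rewrite QE /F g1 g2; lra.
Qed.

End SharpEstimate.

(** * The logarithm of a positive solution *)

Section LogTransform.
Context {R : realType} {n : nat}.
Local Set Implicit Arguments.
Local Unset Strict Implicit.
Local Unset Printing Implicit Defensive.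
Local Notation e := (@basis_vec R n).

Lemma derivable_line (G : 'rV[R]_n -> R) x v : derivable G x v ->
  has_derive (fun r => G (x + r *: v)) 0 ('D_v G x).
Proof.
move=> D; apply/has_deriveP.
have E : (fun h : R => h^-1 * (G (x + (h + 0) *: v) - G (x + 0 *: v))) =
         (fun h : R => h^-1 *: ((G \o shift x) (h *: v) - G x)).
  by apply/funext => h /=; rewrite scale0r !addr0 [x + _]addrC.
by rewrite E; exact: D.
Qed.

Lemma log_solution_ln (a b : R) (f : 'rV[R]_n -> R -> R) : NW_solution a b f ->
  (forall x t, 0 <= t -> 0 < f x t) ->
  log_solution a b (fun x t => ln (f x t)) (fun x t => dt f x t / f x t)
    (fun i x t => dx i f x t / f x t)
    (fun i x t => dx i (dx i f) x t / f x t - (dx i f x t / f x t) ^+ 2).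
Proof.
move=> [_ [Dt Dx Dxx [Cf _] [Cx Cxx]] Heq] pos.
have f0 x t : 0 < t -> 0 < f x t by move=> t0; apply: pos; exact: ltW.
have fn x t : 0 < t -> f x t != 0 by move=> t0; rewrite gt_eqF // f0.
have Hx i : line_derive i f (dx i f) by move=> x t t0; exact: derivable_line (Dx i x t t0).
have Hxx i : line_derive i (dx i f) (dx i (dx i f)).
  by move=> x t t0; exact: derivable_line (Dxx i i x t t0).
have quotient_cvg (G : 'rV[R]_n -> R -> R) : jointly_continuous G ->
    jointly_continuous (fun x t => G x t / f x t).
  move=> CG; apply: jointly_continuous_fun => x t t0 T F FF X Y HX HY.
  apply: cvgM_fun; first exact: joint_cvg.
  by apply: cvgV; [exact: fn|exact: joint_cvg].
split.
- move=> x t t0; apply: has_derive_ln; last exact: f0.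
  by rewrite /dt derive1E; exact: derivableP (Dt x t t0).
- move=> i x t t0; apply: (has_derive_eq (has_derive_ln (Hx i x t t0) _)).
    by rewrite f0.
  by rewrite scale0r addr0.
- move=> i x t t0; apply: (has_derive_eq (has_deriveM (Hxx i x t t0) (has_deriveV (Hx i x t t0) _))).
    by rewrite fn.
  by rewrite scale0r addr0; field; exact: fn.
- apply: jointly_continuous_fun => x t t0 T F FF X Y HX HY.
  apply: cvg_has_derive; last exact: joint_cvg HX HY.
  exact: is_derive1_ln (f0 _ _ t0).
- by move=> i; exact: quotient_cvg.
- move=> i; apply: jointly_continuous_fun => x t t0 T F FF X Y HX HY.
  apply: cvgB_fun; first by apply: (joint_cvg FF t0 (quotient_cvg _ (Cxx i i))).
  by apply: cvg_sqr_fun; apply: (joint_cvg FF t0 (quotient_cvg _ (Cx i))).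
move=> x t t0; rewrite Heq // /laplacian.
have -> : expR (2 * ln (f x t)) = f x t ^+ 2.
  by rewrite mulrDl mul1r expRD lnK ?posrE ?f0.
have -> : \sum_i (dx i (dx i f) x t / f x t - (dx i f x t / f x t) ^+ 2
    + (dx i f x t / f x t) ^+ 2) = (\sum_i dx i (dx i f) x t) / f x t.
  by rewrite mulr_suml; apply: eq_bigr => i _; rewrite subrK.
by field; exact: fn.
Qed.

End LogTransform.

(** * Exponentiating the integrated estimate *)

Theorem corollary4p1 (R : realType) (n : nat) (hn : (1 <= n)%N)
  (a b : R) (ha : 0 < a) (hb : 0 < b)
  (f : 'rV[R]_n -> R -> R)
  (hsol : NW_solution a b f)
  (hpos : forall (x : 'rV[R]_n) (t : R), 0 <= t -> 0 < f x t)
  (x1 x2 : 'rV[R]_n) (t1 t2 : R) (ht1 : 0 < t1) (ht12 : t1 < t2) :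
  f x2 t2 / f x1 t1 >=
    expR (- enorm (x2 - x1) ^+ 2 / (4 * (t2 - t1)))
    * expR (a * (1 + n%:R / 3) * (t2 - t1))
    * ((1 - expR (2 * a * t1)) / (1 - expR (2 * a * t2))) `^ (2 * n%:R / 3).
Proof.
have t20 : 0 < t2 by exact: lt_trans ht12.
have f1 : 0 < f x1 t1 by apply: hpos; exact: ltW.
have f2 : 0 < f x2 t2 by apply: hpos; exact: ltW.
have E1 : 0 < expR (2 * a * t1) - 1 by rewrite subr_gt0 expR2_gt1.
have E2 : 0 < expR (2 * a * t2) - 1 by rewrite subr_gt0 expR2_gt1.
have := log_harnack (log_solution_ln hsol hpos) hn ha hb x1 x2 ht1 ht12.
have -> : f x2 t2 / f x1 t1 = expR (ln (f x2 t2) - ln (f x1 t1)).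
  by rewrite -ln_div ?posrE // lnK // posrE divr_gt0.
move=> H; apply: le_trans (_ : expR _ <= _); last by rewrite ler_expR; exact: H.
(* Numerator and denominator are both negative; the signs are flipped so that the logarithm of the
   quotient splits. *)
have -> : (1 - expR (2 * a * t1)) / (1 - expR (2 * a * t2)) =
          (expR (2 * a * t1) - 1) / (expR (2 * a * t2) - 1).
  by rewrite -[1 - expR (2 * a * t1)]opprB -[1 - expR (2 * a * t2)]opprB invrN mulrNN.
have q0 : 0 < (expR (2 * a * t1) - 1) / (expR (2 * a * t2) - 1) by rewrite divr_gt0.
rewrite /powR gt_eqF // -!expRD ler_expR ln_div ?posrE //.
rewrite /enorm sqr_sqrtr; last by apply: sumr_ge0 => i _; exact: sqr_ge0.
by rewrite mulNr; lra.
Qed.
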